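(* Let $\tilde A=(\tilde a_{k,\ell})$, $A=(a_{k,\ell})$ be the $s\times s$ matrices of a globally stiffly accurate diagonally implicit IMEX-RK scheme of type-A or type-CK. Suppose that the data $(\rho^n,\mathbf u^n)$ at time $t^n$ are well-prepared, i.e. $$\rho^n=\rho^n_{(0)}+\varepsilon^2\rho^n_{(2)},\qquad \mathbf u^n=\mathbf u^n_{(0)}+\varepsilon\mathbf u^n_{(1)},\qquad \nabla\rho^n_{(0)}=0,\qquad \nabla\cdot\mathbf u^n_{(0)}=0.$$ Let $(\rho^{n+1},\mathbf q^{n+1})=(\rho^s,\mathbf q^s)$, with $\mathbf q=\rho\mathbf u$, be defined by the $s$-stage scheme: for $k=1,\dots,s$, $$\rho^k=\rho^n-\Delta t\sum_{\ell=1}^k a_{k,\ell}\nabla\cdot\mathbf q^\ell,$$ $$\mathbf q^k=\mathbf q^n-\Delta t\sum_{\ell=1}^{k-1}\tilde a_{k,\ell}\left(\nabla\cdot\left(\frac{\mathbf q^\ell\otimes\mathbf q^\ell}{\rho^\ell}\right)+\frac{\nabla(p^\ell-\rho^\ell)}{\varepsilon^2}\right)-\Delta t\sum_{\ell=1}^k a_{k,\ell}\frac{\nabla\rho^\ell}{\varepsilon^2}.$$ If the solution $(\rho^{n+1},\mathbf u^{n+1})$ admits the multiscale decomposition $$\rho^{n+1}=\rho^{n+1}_{(0)}+\varepsilon^2\rho^{n+1}_{(2)},\qquad \mathbf u^{n+1}=\mathbf u^{n+1}_{(0)}+\varepsilon\mathbf u^{n+1}_{(1)},$$ then it is well-prepared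 as well, i.e. $\nabla\rho^{n+1}_{(0)}=0$ and $\nabla\cdot\mathbf u^{n+1}_{(0)}=0$. Further, the scheme reduces, as $\varepsilon\to0$, to a consistent discretisation of the incompressible limit system $$\partial_t\mathbf u_{(0)}+\nabla\cdot(\mathbf u_{(0)}\otimes\mathbf u_{(0)})+\nabla p_{(2)}=0,\qquad \nabla\cdot\mathbf u_{(0)}=0;$$ in other words, the higher-order IMEX-RK scheme is weakly asymptotically consistent.
   Context: Setting: the scaled Euler equations $\partial_t\rho+\nabla\cdot\mathbf q=0$, $\partial_t\mathbf q+\nabla\cdot\left(\frac{\mathbf q\otimes\mathbf q}{\rho}\right)+\frac{\nabla p}{\varepsilon^2}=0$ on a bounded domain $\Omega$ in dimension $d\in\{1,2,3\}$, with density $\rho>0$, momentum $\mathbf q=\rho\mathbf u$, velocity $\mathbf u$, pressure $p(\rho)=\rho^\gamma$ ($\gamma\ge1$), $p^\ell=p(\rho^\ell)$, and scaled Mach number $\varepsilon$. Boundary conditions are periodic or no-flux ($\mathbf u\cdot\nu=0$ on $\partial\Omega$). $\Delta t>0$ is a fixed time step independent of $\varepsilon$. All functions are smooth enough in space for the expressions to make sense. IMEX-RK schemes: an $s$-stage diagonally implicit IMEX-RK scheme has real $s\times s$ matrices with $\tilde a_{i,j}=0$ for $j\ge i$ and $a_{i,j}=0$ for $j>i$, and weights $\tilde\omega,\omega\in\mathbb R^s$, fixed by the usual order conditions (in particular $\sum_j\tilde\omega_j=\sum_j\omega_j=1$). It is globally stiffly accurate (GSA) if $\tilde a_{s,j}=\tilde\omega_j$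 and $a_{s,j}=\omega_j$ for all $j$. It is of type-A if $A$ is invertible. It is of type-CK if $s\ge2$ and $A=\begin{pmatrix}0&0\\ \alpha&A_{s-1}\end{pmatrix}$ with $\alpha\in\mathbb R^{s-1}$ and $A_{s-1}\in\mathbb R^{(s-1)\times(s-1)}$ invertible. Formal asymptotics: all dependent variables, including the stage values $\rho^k,\mathbf u^k$, are taken to admit a multiscale ansatz $f=f_{(0)}+\varepsilon f_{(1)}+\varepsilon^2f_{(2)}$ whose coefficients are functions of $\mathbf x$ independent of $\varepsilon$, with $\rho_{(0)}>0$. The expansions are inserted into the scheme, nonlinear expressions such as $p(\rho)$ and $1/\rho$ are Taylor-expanded in $\varepsilon$, and the coefficients of like powers $\varepsilon^{-2},\varepsilon^{-1},\varepsilon^0$ are equated; the statement concerns the resulting relations between the coefficients. Weak asymptotic consistency means that, when the data at time $t^n$ are well-prepared, the scheme turns in the limit $\varepsilon\to0$ (i.e. at leading order) into a scheme for the limit system. That the scheme reduces to a consistent discretisation of the limit system (with the pressure $p_{(2)}$ scaled by the constant $\rho_{(0)}$) means here that the leading-order coefficients satisfy, for $k=1,\dots,s$ and some scalar functions $\pi^k$, $$\mathbf u^k_{(0)}=\mathbf u^n_{(0)}-\Delta t\sum_{\ell=1}^{k-1}\tilde a_{k,\ell}\nabla\cdot(\mathbf u^\ell_{(0)}\otimes\mathbf u^\ell_{(0)})-\Delta t\,\nabla\pi^k,\qquad \nabla\cdot\mathbf u^k_{(0)}=0,$$ with $\mathbf u^{n+1}_{(0)}=\mathbf u^s_{(0)}$,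 the functions $\pi^k$ playing the role of the incompressible pressure. *)

(* Defs.v *)
From HB Require Import structures.
From mathcomp Require Import all_boot all_order all_algebra.
From mathcomp Require Import all_classical all_reals all_analysis.

Set Implicit Arguments.
Unset Strict Implicit.
Unset Printing Implicit Defensive.

Import Order.TTheory GRing.Theory Num.Theory.
Import numFieldNormedType.Exports.

Local Open Scope classical_set_scope.
Local Open Scope ring_scope.

(* Points and vectors are row vectors.  Fields are functions on the whole
   space, but in the no-flux case below only their values on the domain and
   its closure matter. *)

Definition partial (R : realType) (d : nat) (i : 'I_d)
    (f : 'rV[R]_d -> R) (x : 'rV[R]_d) : R :=
  'D_(delta_mx 0 i) f x.

Definition grad (R : realType) (d : nat)
    (f : 'rV[R]_d -> R) (x : 'rV[R]_d) : 'rV[R]_d :=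
  \row_i partial i f x.

Definition div (R : realType) (d : nat)
    (v : 'rV[R]_d -> 'rV[R]_d) (x : 'rV[R]_d) : R :=
  \sum_i partial i (fun y => v y 0 i) x.

Definition div_tensor (R : realType) (d : nat)
    (T : 'rV[R]_d -> 'M[R]_d) (x : 'rV[R]_d) : 'rV[R]_d :=
  \row_i \sum_j partial j (fun y => T y i j) x.

Definition tensor (R : realType) (d : nat) (v w : 'rV[R]_d) : 'M[R]_d :=
  v^T *m w.

Definition dotp (R : realType) (d : nat) (v w : 'rV[R]_d) : R :=
  \sum_i v 0 i * w 0 i.

Definition C1_on (R : realType) (d : nat)
    (U : set 'rV[R]_d) (f : 'rV[R]_d -> R) : Prop :=
  forall x, U x ->
    differentiable f x /\ forall i, {for x, continuous (partial i f)}.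

(* Near the boundary point x, Omega is {g_0 < 0, ..., g_(m-1) < 0} with
   independent gradients at x.  The case m = 1 is a C^1 boundary point; m > 1
   allows corners and edges, so that boxes are covered. *)
Definition boundary_chart (R : realType) (d : nat) (Omega : set 'rV[R]_d)
    (x : 'rV[R]_d) (m : nat) (U : set 'rV[R]_d)
    (g : 'I_m -> 'rV[R]_d -> R) : Prop :=
  [/\ open_nbhs x U,
      forall i, C1_on U (g i) /\ g i x = 0,
      row_free (\matrix_(i < m) grad (g i) x) &
      forall y, U y -> (Omega y <-> forall i, g i y < 0)].

Definition outward_normal (R : realType) (d : nat) (Omega : set 'rV[R]_d)
    (x nu : 'rV[R]_d) : Prop :=
  exists (m : nat) (U : set 'rV[R]_d) (g : 'I_m -> 'rV[R]_d -> R) (i : 'I_m),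
    boundary_chart Omega x U g /\
    nu = (Num.sqrt (dotp (grad (g i) x) (grad (g i) x)))^-1 *: grad (g i) x.

Definition boundary (R : realType) (d : nat) (Omega : set 'rV[R]_d) :
    set 'rV[R]_d :=
  closure Omega `\` Omega°.

Definition bounded_domain (R : realType) (d : nat) (Omega : set 'rV[R]_d) :
    Prop :=
  [/\ open Omega, connected Omega, Omega !=set0, bounded_set Omega &
      forall x, boundary Omega x ->
        exists (m : nat) (U : set 'rV[R]_d) (g : 'I_m -> 'rV[R]_d -> R),
          boundary_chart Omega x U g].

(* [Periodic L] is the box with side lengths [L 0 i] and opposite faces
   identified: fields are L-periodic functions on the whole space. *)
Inductive geometry (R : realType) (d : nat) : Type :=
| Periodic of 'rV[R]_d
| NoFlux of set 'rV[R]_d.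

Definition geometry_ok (R : realType) (d : nat) (D : geometry R d) : Prop :=
  match D with
  | Periodic L => forall i, 0 < L 0 i
  | NoFlux Omega => bounded_domain Omega
  end.

Definition points (R : realType) (d : nat) (D : geometry R d) :
    set 'rV[R]_d :=
  match D with
  | Periodic _ => setT
  | NoFlux Omega => Omega
  end.

Definition smooth_scalar (R : realType) (d : nat) (D : geometry R d)
    (f : 'rV[R]_d -> R) : Prop :=
  C1_on (points D) f /\
  match D with
  | Periodic L => forall x i, f (x + L 0 i *: delta_mx 0 i) = f x
  | NoFlux Omega => {within closure Omega, continuous f}
  end.

Definition smooth_vector (R : realType) (d : nat) (D : geometry R d)
    (v : 'rV[R]_d -> 'rV[R]_d) : Prop :=
  forall i, smooth_scalar D (fun x => v x 0 i).

Definition boundary_condition (R : realType) (d : nat) (D : geometry R d)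
    (v : 'rV[R]_d -> 'rV[R]_d) : Prop :=
  match D with
  | Periodic _ => True
  | NoFlux Omega => forall x nu,
      boundary Omega x -> outward_normal Omega x nu -> dotp (v x) nu = 0
  end.

(* The triple of coefficients of f_(0) + eps f_(1) + eps^2 f_(2). *)
Record ansatz (R : realType) (d : nat) (V : Type) : Type := Ansatz {
  order0 : 'rV[R]_d -> V;
  order1 : 'rV[R]_d -> V;
  order2 : 'rV[R]_d -> V }.

Definition at_eps (R : realType) (d : nat) (V : lmodType R)
    (f : ansatz R d V) (eps : R) (x : 'rV[R]_d) : V :=
  order0 f x + eps *: order1 f x + eps ^+ 2 *: order2 f x.

(* F(eps) = eps^-2 c2 + eps^-1 c1 + c0 + o(1) as eps -> 0+; the coefficients
   are unique. *)
Definition eps_expansion (R : realType) (V : normedModType R)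
    (F : R -> V) (c2 c1 c0 : V) : Prop :=
  (F eps - (eps ^- 2 *: c2 + eps^-1 *: c1 + c0)) @[eps --> 0^'+] --> (0 : V).

(* Equality of the coefficients of eps^-2, eps^-1 and eps^0. *)
Definition formally_equal (R : realType) (V : normedModType R)
    (F G : R -> V) : Prop :=
  exists c2 c1 c0 : V, eps_expansion F c2 c1 c0 /\ eps_expansion G c2 c1 c0.

Definition admissible_state (R : realType) (d : nat) (D : geometry R d)
    (rho : ansatz R d R^o) (u : ansatz R d 'rV[R]_d) : Prop :=
  [/\ [/\ smooth_scalar D (order0 rho), smooth_scalar D (order1 rho) &
          smooth_scalar D (order2 rho)],
      [/\ smooth_vector D (order0 u), smooth_vector D (order1 u) &
          smooth_vector D (order2 u)],
      [/\ boundary_condition D (order0 u), boundary_condition D (order1 u) &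
          boundary_condition D (order2 u)] &
      forall x, points D x -> 0 < order0 rho x].

(* rho = rho_(0) + eps^2 rho_(2) and u = u_(0) + eps u_(1). *)
Definition low_mach_form (R : realType) (d : nat) (D : geometry R d)
    (rho : ansatz R d R^o) (u : ansatz R d 'rV[R]_d) : Prop :=
  forall x, points D x -> order1 rho x = 0 /\ order2 u x = 0.

Definition well_prepared (R : realType) (d : nat) (D : geometry R d)
    (rho : ansatz R d R^o) (u : ansatz R d 'rV[R]_d) : Prop :=
  low_mach_form D rho u /\
  forall x, points D x -> grad (order0 rho) x = 0 /\ div (order0 u) x = 0.

(* IMEX-RK schemes; there are s.+1 stages, indexed from 0, so the last stage
   is [ord_max].  [At] is the explicit tableau and [A] the implicit one. *)
Definition dimex_rk (R : realType) (s : nat) (At A : 'M[R]_s.+1)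
    (wt w : 'rV[R]_s.+1) : Prop :=
  [/\ forall i j : 'I_s.+1, (i <= j)%N -> At i j = 0,
      forall i j : 'I_s.+1, (i < j)%N -> A i j = 0,
      \sum_j wt 0 j = 1 &
      \sum_j w 0 j = 1].

Definition globally_stiffly_accurate (R : realType) (s : nat)
    (At A : 'M[R]_s.+1) (wt w : 'rV[R]_s.+1) : Prop :=
  forall j, At ord_max j = wt 0 j /\ A ord_max j = w 0 j.

Definition type_A (R : realType) (s : nat) (A : 'M[R]_s.+1) : Prop :=
  A \in unitmx.

Definition type_CK (R : realType) (s : nat) (A : 'M[R]_s.+1) : Prop :=
  (0 < s)%N /\
  exists (alpha : 'cV[R]_s) (As : 'M[R]_s),
    As \in unitmx /\ A = block_mx (0 : 'M[R]_1) 0 alpha As.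

Definition pressure (R : realType) (gamma : R) (r : R) : R := r `^ gamma.

Definition momentum (R : realType) (d : nat)
    (rho : ansatz R d R^o) (u : ansatz R d 'rV[R]_d)
    (eps : R) (x : 'rV[R]_d) : 'rV[R]_d :=
  at_eps rho eps x *: at_eps u eps x.

Definition mass_stage (R : realType) (d s : nat) (D : geometry R d)
    (dt : R) (A : 'M[R]_s.+1)
    (rhon : ansatz R d R^o)
    (rho : 'I_s.+1 -> ansatz R d R^o) (u : 'I_s.+1 -> ansatz R d 'rV[R]_d)
    (k : 'I_s.+1) : Prop :=
  forall x, points D x ->
    formally_equal
      (fun eps => at_eps (rho k) eps x)
      (fun eps => at_eps rhon eps x
        - dt * \sum_(l < s.+1 | (l <= k)%N)
                 A k l * div (momentum (rho l) (u l) eps) x : R^o).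

Definition momentum_stage (R : realType) (d s : nat) (D : geometry R d)
    (gamma dt : R) (At A : 'M[R]_s.+1)
    (rhon : ansatz R d R^o) (un : ansatz R d 'rV[R]_d)
    (rho : 'I_s.+1 -> ansatz R d R^o) (u : 'I_s.+1 -> ansatz R d 'rV[R]_d)
    (k : 'I_s.+1) : Prop :=
  forall x, points D x ->
    formally_equal
      (fun eps => momentum (rho k) (u k) eps x)
      (fun eps => momentum rhon un eps x
        - dt *: \sum_(l < s.+1 | (l < k)%N) At k l *:
            (div_tensor (fun y => (at_eps (rho l) eps y)^-1 *:
                tensor (momentum (rho l) (u l) eps y)
                       (momentum (rho l) (u l) eps y)) x
             + eps ^- 2 *: grad (fun y => pressure gamma (at_eps (rho l) eps y)
                                          - at_eps (rho l) eps y) x)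
        - dt *: \sum_(l < s.+1 | (l <= k)%N) A k l *:
            (eps ^- 2 *: grad (at_eps (rho l) eps) x)).

(* (rho^(n+1), q^(n+1)) = (rho^s, q^s). *)
Definition final_update (R : realType) (d s : nat) (D : geometry R d)
    (rho : 'I_s.+1 -> ansatz R d R^o) (u : 'I_s.+1 -> ansatz R d 'rV[R]_d)
    (rhon1 : ansatz R d R^o) (un1 : ansatz R d 'rV[R]_d) : Prop :=
  forall x, points D x ->
    formally_equal (fun eps => at_eps rhon1 eps x)
                   (fun eps => at_eps (rho ord_max) eps x) /\
    formally_equal (fun eps => momentum rhon1 un1 eps x)
                   (fun eps => momentum (rho ord_max) (u ord_max) eps x).

(* The discretisation of the incompressible limit system, with pressures
   [psi k]. *)
Definition incompressible_scheme (R : realType) (d s : nat)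
    (D : geometry R d) (dt : R) (At : 'M[R]_s.+1)
    (un : 'rV[R]_d -> 'rV[R]_d) (u : 'I_s.+1 -> 'rV[R]_d -> 'rV[R]_d)
    (un1 : 'rV[R]_d -> 'rV[R]_d) : Prop :=
  (exists psi : 'I_s.+1 -> 'rV[R]_d -> R,
     forall k, smooth_scalar D (psi k) /\
       forall x, points D x ->
         u k x = un x
           - dt *: \sum_(l < s.+1 | (l < k)%N)
               At k l *: div_tensor (fun y => tensor (u l y) (u l y)) x
           - dt *: grad (psi k) x) /\
  (forall k x, points D x -> div (u k) x = 0) /\
  (forall x, points D x -> un1 x = u ord_max x).

(* Main.v *)
Require Import Defs.
From HB Require Import structures.
From mathcomp Require Import all_boot all_order all_algebra.
From mathcomp Require Import all_classical all_reals all_analysis.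
From mathcomp Require Import ring lra.

(* Induct on the stages.  The coefficient of eps^-2 in the momentum equation and
   A_kk <> 0 give grad rho^k_(0) = 0, so rho^k_(0) is constant on the connected
   domain, and the mass equation at order 0 then says that div u^k_(0) is constant.
   By the divergence theorem and the boundary conditions this constant vanishes,
   whence rho^k_(0) = rho^n_(0).  In the CK case the first stage is the data.  Once
   the eps^-1 coefficients cancel, the order-0 momentum equation is the
   incompressible scheme, the remaining terms being a gradient.

   The divergence theorem (div v = c with v tangent to the boundary implies c = 0)
   is proved without integrals, by averaging over the points of a grid: the averages
   of the partial derivatives of a field whose values on opposite faces of a box
   agree telescope up to o(1).  A periodic field is of this kind.  In the no-flux
   case the field is cut off in a layer of width delta along the boundary, which
   contains a proportion O(delta) of the grid points, while the cutoff contributes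
   only v.grad g / delta, and v.grad g = o(1) in the layer. *)

Set Implicit Arguments.
Unset Strict Implicit.
Unset Printing Implicit Defensive.

Import Order.TTheory GRing.Theory Num.Theory.
Import numFieldNormedType.Exports.

Local Open Scope classical_set_scope.
Local Open Scope ring_scope.

(** * Functions with continuous partial derivatives *)

(** The obstacle is the no-flux domain, which may have corners and on which the fields are C^1
    inside but only continuous up to the closure. There v.grad g tends to 0 at the boundary without
    any rate, so smallness has to come from this term alone: the factor 1 / delta and the proportion
    O(delta) only cancel each other. The proportion is O(delta) because a chart function with a
    nonzero partial derivative is locally monotone along one axis, so its layer meets each grid line
    parallel to that axis in a short piece. At a corner the complement of the domain is locally a
    union of sets [0 <= g i y], treated one at a time; products of cutoffs deal with finite unions,
    and compactness of the boundary makes finitely many suffice. The cut-off field, extended by 0,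
    is C^1 on the whole space. If c were nonzero, the averages of c times the indicator of the
    domain could not become small, since a ball inside the domain keeps a fixed share of the points
    of suitable grids. *)

Lemma cvg_sumr {R : numFieldType} {V : normedModType R} {T I : Type}
    (F : set_system T) {FF : Filter F} (r : seq I) (P : pred I) (f : I -> T -> V) (l : I -> V) :
  (forall i, P i -> f i x @[x --> F] --> l i) ->
  \sum_(i <- r | P i) f i x @[x --> F] --> \sum_(i <- r | P i) l i.
Proof. by apply: cvg_big; exact: add_continuous. Qed.

Lemma cvg_prodr {R : numFieldType} {T I : Type}
    (F : set_system T) {FF : Filter F} (r : seq I) (P : pred I) (f : I -> T -> R) (l : I -> R) :
  (forall i, P i -> f i x @[x --> F] --> l i) ->
  \prod_(i <- r | P i) f i x @[x --> F] --> \prod_(i <- r | P i) l i.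
Proof. by apply: cvg_big; exact: mul_continuous. Qed.

(** Total differentiability is left out: the averages and the chain rule along an axis see partial
    derivatives only, and this form passes easily through gluing, products and compositions. *)
Definition pC1 (R : realType) (d : nat) (U : set 'rV[R]_d)
    (f : 'rV[R]_d -> R) : Prop :=
  forall x, U x -> {for x, continuous f} /\ forall i,
    derivable f x (delta_mx 0 i) /\ {for x, continuous (partial i f)}.

Section partial_calculus.
Context {R : realType} {d : nat}.
Implicit Types (f g : 'rV[R]_d -> R) (x : 'rV[R]_d) (U : set 'rV[R]_d).

Lemma eq_near_partial f g x i :
  {near x, f =1 g} -> partial i f x = partial i g x.
Proof. exact: near_eq_derive. Qed.

Lemma eq_near_continuous f g x :
  {near x, f =1 g} -> {for x, continuous f} -> {for x, continuous g}.
Proof.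
move=> fg cf; rewrite /prop_for /continuous_at -(nbhs_singleton fg).
exact: cvg_trans (near_eq_cvg fg) cf.
Qed.

Lemma C1_on_pC1 U f : C1_on U f -> pC1 U f.
Proof.
move=> fU x Ux; have [df cf] := fU _ Ux.
by split=> [|i]; [exact: differentiable_continuous|split; [exact: diff_derivable|]].
Qed.

Lemma eq_pC1 U f g : open U -> (forall x, U x -> f x = g x) ->
  pC1 U f -> pC1 U g.
Proof.
move=> oU fg fU x Ux; have [cf df] := fU _ Ux.
have nfg y : U y -> {near y, f =1 g}.
  by move=> Uy; apply: filterS (open_nbhs_nbhs (conj oU Uy)) => z /fg.
split=> [|i]; first by apply: eq_near_continuous cf; exact: nfg.
have [df1 df2] := df i; split.
  by apply: near_eq_derivable df1; exact: nfg.
apply: eq_near_continuous df2; near=> y; apply: eq_near_partial; apply: nfg.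
by near: y; exact: open_nbhs_nbhs.
Unshelve. all: by end_near. Qed.

Lemma pC1U U V f : pC1 U f -> pC1 V f -> pC1 (U `|` V) f.
Proof. by move=> fU fV x [/fU|/fV]. Qed.

Lemma pC1S U V f : U `<=` V -> pC1 V f -> pC1 U f.
Proof. by move=> UV fV x /UV/fV. Qed.

Lemma partial_cst (c : R) x i : partial i (fun=> c) x = 0.
Proof. exact: derive_cst. Qed.

Lemma pC1_cst U (c : R) : pC1 U (fun=> c).
Proof.
move=> x _; split=> [|i]; first exact: cst_continuous.
split; first exact: derivable_cst.
rewrite (_ : partial i _ = fun=> 0); first exact: cst_continuous.
by apply/funext => y; exact: partial_cst.
Qed.

Lemma partialD f g x i : derivable f x (delta_mx 0 i) ->
  derivable g x (delta_mx 0 i) ->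
  partial i (fun y => f y + g y) x = partial i f x + partial i g x.
Proof. by move=> df dg; exact: (deriveD df dg). Qed.

Lemma partialN f x i : derivable f x (delta_mx 0 i) ->
  partial i (fun y => - f y) x = - partial i f x.
Proof. by move=> df; exact: (deriveN df). Qed.

Lemma partialM f g x i : derivable f x (delta_mx 0 i) ->
  derivable g x (delta_mx 0 i) ->
  partial i (fun y => f y * g y) x = f x * partial i g x + g x * partial i f x.
Proof. by move=> df dg; exact: (deriveM df dg). Qed.

Lemma is_derive_line f x v (t : R) : derivable f (t *: v + x) v ->
  is_derive t 1 (fun u : R => f (u *: v + x)) ('D_v f (t *: v + x)).
Proof.
have E : (fun h : R => h^-1 *: (((fun u : R => f (u *: v + x)) \o shift t)
      (h *: 1) - f (t *: v + x))) =
    fun h => h^-1 *: ((f \o shift (t *: v + x)) (h *: v) - f (t *: v + x)).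
  by apply/funext => h /=; rewrite [h *: 1]mulr1 scalerDl addrA.
by move=> df; split; rewrite /derivable /derive E.
Qed.

Lemma partial_MVT f x i (t : R) : 0 <= t ->
  (forall u : R, 0 <= u <= t ->
    derivable f (u *: delta_mx 0 i + x) (delta_mx 0 i)) ->
  exists2 u : R, 0 <= u <= t & f (t *: delta_mx 0 i + x) - f x =
    partial i f (u *: delta_mx 0 i + x) * t.
Proof.
set e := delta_mx 0 i => t0 df.
have [||u] := @MVT_segment R (fun u => f (u *: e + x))
  (fun u => partial i f (u *: e + x)) 0 t t0.
- move=> u; rewrite in_itv/= => /andP[u0 ut].
  by apply: is_derive_line; apply: df; rewrite !ltW.
- apply: continuous_in_subspaceT => u; rewrite inE/= in_itv/= => /df du.
  apply: differentiable_continuous; apply/derivable1_diffP.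
  by case: (is_derive_line du).
by rewrite in_itv/= scale0r add0r subr0 => u0t ->; exists u.
Qed.

(** Along the line through [x] in direction [i] this is the chain rule in one variable, so [k] has
    to be differentiable only at the value [f x]. *)
Lemma partial_comp (k dk : R -> R) f x i : is_derive (f x) 1 k (dk (f x)) ->
  derivable f x (delta_mx 0 i) ->
  is_derive x (delta_mx 0 i) (fun y => k (f y)) (dk (f x) * partial i f x).
Proof.
set e := delta_mx 0 i => kd fd.
have fd0 : is_derive (0 : R) 1 (fun h : R => f (h *: e + x)) (partial i f x).
  split; first exact: (derivable1P f x e).1.
  rewrite /partial /derive; set g1 := fun h => _; set g2 := fun h => h^-1 *: _.
  suff -> : g1 = g2 by []; apply/funext => h; rewrite /g1 /g2 /=.
  by rewrite !addr0 scale0r add0r [h%:A]mulr1.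
have kfd : is_derive (0 : R) 1 (k \o (fun h : R => f (h *: e + x)))
    (dk (f x) * partial i f x).
  by apply: is_derive1_comp; rewrite scale0r add0r.
case: kfd => [kd1 kd2]; split; first exact: (derivable1P (fun y => k (f y)) x e).2.
rewrite -kd2 /derive; set g1 := fun h => _; set g2 := fun h => h^-1 *: _.
suff -> : g1 = g2 by []; apply/funext => h; rewrite /g1 /g2 /=.
by rewrite !addr0 scale0r add0r [h%:A]mulr1.
Qed.

Lemma pC1D U f g : open U -> pC1 U f -> pC1 U g -> pC1 U (fun x => f x + g x).
Proof.
move=> oU fU gU x Ux; have [cf df] := fU _ Ux; have [cg dg] := gU _ Ux.
split=> [|i]; first exact: (continuousD cf cg).
have [df1 df2] := df i; have [dg1 dg2] := dg i.
split; first exact: (derivableD df1 dg1).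
apply: (@eq_near_continuous (fun y => partial i f y + partial i g y)).
  near=> y; have Uy : U y by near: y; exact: open_nbhs_nbhs.
  exact: esym (partialD ((fU _ Uy).2 i).1 ((gU _ Uy).2 i).1).
exact: (continuousD df2 dg2).
Unshelve. all: by end_near. Qed.

Lemma pC1N U f : open U -> pC1 U f -> pC1 U (fun x => - f x).
Proof.
move=> oU fU x Ux; have [cf df] := fU _ Ux.
split=> [|i]; first exact: (continuousN cf).
have [df1 df2] := df i.
split; first exact: (derivableN df1).
apply: (@eq_near_continuous (fun y => - partial i f y)).
  near=> y; have Uy : U y by near: y; exact: open_nbhs_nbhs.
  exact: esym (partialN ((fU _ Uy).2 i).1).
exact: (continuousN df2).
Unshelve. all: by end_near. Qed.

Lemma pC1M U f g : open U -> pC1 U f -> pC1 U g -> pC1 U (fun x => f x * g x).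
Proof.
move=> oU fU gU x Ux; have [cf df] := fU _ Ux; have [cg dg] := gU _ Ux.
split=> [|i]; first exact: (continuousM cf cg).
have [df1 df2] := df i; have [dg1 dg2] := dg i.
split; first exact: (derivableM df1 dg1).
apply: (@eq_near_continuous
  (fun y => f y * partial i g y + g y * partial i f y)).
  near=> y; have Uy : U y by near: y; exact: open_nbhs_nbhs.
  exact: esym (partialM ((fU _ Uy).2 i).1 ((gU _ Uy).2 i).1).
exact: (continuousD (continuousM cf dg2) (continuousM cg df2)).
Unshelve. all: by end_near. Qed.

Lemma pC1_comp U (k dk : R -> R) f : open U ->
  (forall t : R, is_derive t 1 k (dk t)) -> continuous dk ->
  pC1 U f -> pC1 U (fun x => k (f x)).
Proof.
move=> oU kd ck fU x Ux; have [cf df] := fU _ Ux.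
have ckf : {for x, continuous (fun x => k (f x))}.
  apply: (@continuous_comp _ _ _ f k) => //.
  by apply: differentiable_continuous; apply/derivable1_diffP; case: (kd (f x)).
split=> // i; have [df1 df2] := df i.
split; first by case: (partial_comp (kd _) df1).
apply: (@eq_near_continuous (fun y => dk (f y) * partial i f y)).
  near=> y; have Uy : U y by near: y; exact: open_nbhs_nbhs.
  by have [_ <-] := partial_comp (kd _) ((fU _ Uy).2 i).1.
apply: continuousM => //.
by apply: (@continuous_comp _ _ _ f dk) => //; exact: ck.
Unshelve. all: by end_near. Qed.

Lemma pC1_sum U n (F : 'I_n -> 'rV[R]_d -> R) : open U ->
  (forall j, pC1 U (F j)) -> pC1 U (fun x => \sum_j F j x).
Proof.
move=> oU; elim: n F => [F _|n IH F FU].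
  by apply: (eq_pC1 oU _ (@pC1_cst U 0)) => x _; rewrite big_ord0.
apply: (eq_pC1 oU (f := fun x => F ord0 x + \sum_j F (lift ord0 j) x)).
  by move=> x _; rewrite big_ord_recl.
by apply: pC1D => //; apply: IH.
Qed.

Lemma is_derive_coord x i j :
  is_derive x (delta_mx 0 i) (fun y : 'rV[R]_d => y 0 j) ((i == j)%:R).
Proof.
have lin : differentiable (fun y : 'rV[R]_d => y 0 j) x.
  exact: differentiable_coord.
split; first exact: diff_derivable.
apply: cvg_lim => //.
apply: (@cvg_trans _ ((fun=> (i == j)%:R) @ (0 : R)^')); last exact: cvg_cst.
apply: near_eq_cvg; near=> h.
have h0 : h != 0 by near: h; exact: nbhs_dnbhs_neq.
by rewrite /= !mxE eqxx/= addrK [_ *: _]mulrA mulVf// mul1r eq_sym.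
Unshelve. all: by end_near. Qed.

Lemma pC1_coord U j : pC1 U (fun y : 'rV[R]_d => y 0 j).
Proof.
move=> x _; split=> [|i]; first exact: coord_continuous.
split; first by case: (is_derive_coord x i j).
rewrite (_ : partial i _ = fun=> (i == j)%:R); first exact: cst_continuous.
by apply/funext => y; have [_ <-] := is_derive_coord y i j.
Qed.

End partial_calculus.

(** * A cutoff function *)

Section cutoff.
Context {R : realType}.

(** Meant for [sqp], whose formula changes at 0: a quadratic error bound reduces differentiability
    to one polynomial inequality per sign case. *)
Lemma is_derive_quadratic (f : R -> R) (x a C : R) :
  (forall h, `|f (h + x) - f x - a * h| <= C * h ^+ 2) -> is_derive x 1 f a.
Proof.
move=> fC0.
have C0 : 0 < `|C| + 1 by rewrite ltr_wpDl.
have fC h : `|f (h + x) - f x - a * h| <= (`|C| + 1) * h ^+ 2.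
  apply: le_trans (fC0 h) _; apply: ler_wpM2r; first exact: sqr_ge0.
  by rewrite (le_trans (ler_norm _))// lerDl.
have cvg_a : (h^-1 *: ((f \o shift x) (h *: (1 : R)) - f x)) @[h --> 0^'] --> a.
  apply/cvgrPdist_le => /= e e0; near=> h.
  have h0 : h != 0 by near: h; exact: nbhs_dnbhs_neq.
  rewrite /= [h *: 1]mulr1 [_ *: _]mulrC.
  have -> : a - (f (h + x) - f x) / h = - (f (h + x) - f x - a * h) / h.
    by field.
  rewrite mulNr normrN normrM normfV ler_pdivrMr ?normr_gt0//.
  apply: (le_trans (fC h)); rewrite -real_normK ?num_real// expr2 mulrA.
  rewrite ler_pM2r ?normr_gt0//.
  rewrite -ler_pdivlMl//.
  by near: h; apply: dnbhs0_le; rewrite mulr_gt0 ?invr_gt0.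
by split; [apply/cvg_ex; exists a|exact: cvg_lim].
Unshelve. all: by end_near. Qed.

Definition sqp (t : R) : R := Num.max t 0 ^+ 2.

Lemma is_derive_sqp (t : R) : is_derive t 1 sqp (2 * Num.max t 0).
Proof.
apply: (@is_derive_quadratic _ _ _ 1) => h; rewrite mul1r ler_norml /sqp.
by case: (leP t 0) => t0; case: (leP (h + t) 0) => ht0; apply/andP; split; nra.
Qed.

(* The composite [p (1 - p (t - 1))] of squared positive parts [p] is C^1, equals
   1 for [t <= 1] and 0 for [t >= 2]. *)
Definition cutoff (t : R) : R := sqp (1 - sqp (t - 1)).

Definition dcutoff (t : R) : R :=
  2 * Num.max (1 - sqp (t - 1)) 0 * - (2 * Num.max (t - 1) 0).

Lemma is_derive_cutoff (t : R) : is_derive t 1 cutoff (dcutoff t).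
Proof.
apply: (@is_derive1_comp _ sqp (fun t => 1 - sqp (t - 1))).
  exact: is_derive_sqp.
have d1 : is_derive t 1 (fun t => sqp (t - 1)) (2 * Num.max (t - 1) 0 * 1).
  apply: (@is_derive1_comp _ sqp (fun t => t - 1)); first exact: is_derive_sqp.
  by apply: is_derive_eq; rewrite subr0.
by apply: is_derive_eq; rewrite add0r mul1r mulr1.
Qed.

Lemma continuous_dcutoff : continuous dcutoff.
Proof.
have cmax : continuous (fun t : R => Num.max t 0).
  by move=> t; apply: continuous_max => //; exact: cvg_cst.
have csqp : continuous sqp by move=> t; exact: (continuous_comp (cmax t) (@exprn_continuous _ 2 _)).
have cs : continuous (fun t : R => t - 1).
  by move=> t; apply: cvgB => //; exact: cvg_cst.
have cs1 : continuous (fun t : R => sqp (t - 1)).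
  by move=> t; apply: (continuous_comp (cs t) (csqp _)).
have cs2 : continuous (fun t : R => 1 - sqp (t - 1)).
  by move=> t; apply: cvgB; [exact: cvg_cst|exact: cs1].
move=> t; apply: cvgM.
  apply: cvgM; first exact: cvg_cst.
  exact: (continuous_comp (cs2 t) (cmax _)).
apply: cvgN; apply: cvgM; first exact: cvg_cst.
exact: (continuous_comp (cs t) (cmax _)).
Qed.

Lemma cutoff_ge0 t : 0 <= cutoff t.
Proof. exact: sqr_ge0. Qed.

Lemma cutoff_le1 t : cutoff t <= 1.
Proof.
rewrite /cutoff /sqp; move: (sqr_ge0 (Num.max (t - 1) 0)).
set u := _ ^+ 2 => u0.
by case: (leP (1 - u) 0) => u1; nra.
Qed.

Lemma cutoff1 t : t <= 1 -> cutoff t = 1.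
Proof.
rewrite -subr_le0 => t1; rewrite /cutoff /sqp (max_idPr t1) expr0n/= subr0.
by rewrite (max_idPl _) ?expr1n.
Qed.

Lemma sqp_ge1 t : 2 <= t -> 1 - sqp (t - 1) <= 0.
Proof.
move=> t2; rewrite /sqp (max_idPl _); last by lra.
by nra.
Qed.

Lemma cutoff0 t : 2 <= t -> cutoff t = 0.
Proof.
by move=> t2; rewrite /cutoff {1}/sqp (max_idPr _) ?expr0n// sqp_ge1.
Qed.

Lemma dcutoff0 t : 2 <= t -> dcutoff t = 0.
Proof.
by move=> t2; rewrite /dcutoff (max_idPr (sqp_ge1 t2)) mulr0 mul0r.
Qed.

(** For [t < 2] both maxima lie in [0, 1], and 4 is the product of the factors 2 from the two
    squares. *)
Lemma dcutoff_bound t : `|dcutoff t| <= 4.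
Proof.
have [t2|t2] := leP 2 t; first by rewrite dcutoff0// normr0.
rewrite /dcutoff /sqp ler_norml.
have : 0 <= Num.max (t - 1) 0 <= 1.
  by case: (leP (t - 1) 0) => ?; apply/andP; split; lra.
set u := Num.max (t - 1) 0 => /andP[u0 u1].
have : 0 <= Num.max (1 - u ^+ 2) 0 <= 1.
  by case: (leP (1 - u ^+ 2) 0) => ?; apply/andP; split; nra.
set v := Num.max _ 0 => /andP[v0 v1].
by apply/andP; split; nra.
Qed.

End cutoff.

(** * Averages over grids *)

Section grid_average.
Context {R : realType} {d : nat}.
Variables a L : 'rV[R]_d.
Hypothesis L0 : forall i, 0 < L 0 i.
Implicit Types (f g : 'rV[R]_d -> R) (n : nat).

Definition box : set 'rV[R]_d :=
  [set x | forall i, x 0 i \in `[a 0 i, a 0 i + L 0 i]].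

(** The indices stop at [n - 1], so only one of two opposite faces is sampled, and a shift by one
    step permutes the grid once these faces are identified. *)
Definition gridpt n (z : {ffun 'I_d -> 'I_n}) : 'rV[R]_d :=
  \row_i (a 0 i + L 0 i * ((z i)%:R / n%:R)).

Definition avg n f : R :=
  (n%:R ^+ d)^-1 * \sum_(z : {ffun 'I_d -> 'I_n}) f (gridpt z).

Lemma gridpt_box n (z : {ffun 'I_d -> 'I_n}) : box (gridpt z).
Proof.
move=> i; have n0 : (0 < n)%N by case: n z => [z|//]; case: (z i).
rewrite !mxE in_itv/= lerDl lerD2l; apply/andP; split.
  by rewrite mulr_ge0 ?divr_ge0// ltW.
apply: ler_piMr; first exact: ltW.
by rewrite ler_pdivrMr ?ltr0n// mul1r ler_nat ltnW.
Qed.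

Lemma avgD n f g : avg n (fun x => f x + g x) = avg n f + avg n g.
Proof. by rewrite /avg big_split mulrDr. Qed.

Lemma avgN n f : avg n (fun x => - f x) = - avg n f.
Proof. by rewrite /avg sumrN mulrN. Qed.

Lemma avgZ n c f : avg n (fun x => c * f x) = c * avg n f.
Proof. by rewrite /avg -mulr_sumr mulrCA. Qed.

Lemma avg0 n : avg n (fun=> 0) = 0.
Proof. by rewrite /avg big1 ?mulr0. Qed.

Lemma avg_sum n m (F : 'I_m -> 'rV[R]_d -> R) :
  avg n (fun x => \sum_i F i x) = \sum_i avg n (F i).
Proof. by rewrite /avg exchange_big mulr_sumr. Qed.

Lemma avg_cst n c : (0 < n)%N -> avg n (fun=> c) = c.
Proof.
move=> n0; rewrite /avg sumr_const card_ffun !card_ord -[c *+ _]mulr_natl natrX.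
by rewrite mulKf// expf_neq0// pnatr_eq0 -lt0n.
Qed.

Lemma le_avg n f g : (forall x, box x -> f x <= g x) -> avg n f <= avg n g.
Proof.
move=> fg; apply: ler_wpM2l; first by rewrite invr_ge0 exprn_ge0.
by apply: ler_sum => z _; apply: fg; exact: gridpt_box.
Qed.

Lemma eq_avg n f g : (forall x, box x -> f x = g x) -> avg n f = avg n g.
Proof.
by move=> fg; apply/eqP; rewrite eq_le !le_avg// => x /fg ->.
Qed.

Lemma ler_norm_avg n f : `|avg n f| <= avg n (fun x => `|f x|).
Proof.
rewrite ler_norml -avgN; apply/andP; split; apply: le_avg => x _.
  by rewrite lerNl ler_normr lexx orbT.
exact: ler_norm.
Qed.

(** The shift acts on the [i]-th index as the cyclic successor; agreement on opposite faces is what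
    makes the wrap-around of the last index harmless. *)
Lemma avg_shift n f i : (0 < n)%N ->
  (forall x : 'rV[R]_d, x 0 i = a 0 i -> f (x + L 0 i *: delta_mx 0 i) = f x) ->
  avg n (fun x => f (x + (L 0 i / n%:R) *: delta_mx 0 i)) = avg n f.
Proof.
move=> n0 ffaces; rewrite /avg; congr (_ * _).
pose sh (s : 'I_n -> 'I_n) (z : {ffun 'I_d -> 'I_n}) : {ffun 'I_d -> 'I_n} :=
  [ffun j => if j == i then s (z j) else z j].
have shK s s' : cancel s s' -> cancel (sh s) (sh s').
  by move=> ss' z; apply/ffunP => j; rewrite !ffunE; case: eqP => // _.
rewrite [RHS](reindex (sh (@ordS n))) /=; last first.
  exists (sh (@ord_pred n)) => z _; apply: shK; [exact: ordSK|exact: ord_predK].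
apply: eq_bigr => z _.
have nN0 : n%:R != 0 :> R by rewrite pnatr_eq0 -lt0n.
have [zn|zn] := ltnP (z i).+1 n.
  congr f; apply/rowP => j; rewrite !mxE ffunE eqxx/=.
  have [->|ji] := eqVneq j i; last by rewrite mulr0 addr0.
  by rewrite /= modn_small// -natr1; field.
have {}zn : (z i).+1 = n by apply/eqP; rewrite eqn_leq zn ltn_ord.
have zn' : (z i)%:R + 1 = n%:R :> R by rewrite natr1 zn.
rewrite -[RHS]ffaces; last first.
  by rewrite !mxE ffunE eqxx/= zn modnn mul0r mulr0 addr0.
congr f; apply/rowP => j; rewrite !mxE ffunE eqxx/=.
have [->|ji] := eqVneq j i; last by rewrite !mulr0 !addr0.
rewrite /= zn modnn mul0r mulr0 addr0 -addrA; congr (_ + _).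
have -> : (z i)%:R = n%:R - 1 :> R by rewrite -zn' addrK.
by field.
Qed.

Lemma box_compact : compact box.
Proof.
apply: (@rV_compact _ _ (fun i => [set` `[a 0 i, a 0 i + L 0 i]])) => i.
exact: segment_compact.
Qed.

(* Up to a difference quotient, the average of the derivative telescopes. *)
Lemma avg_partial f i :
  (forall x, derivable f x (delta_mx 0 i)) -> continuous (partial i f) ->
  (forall x : 'rV[R]_d, x 0 i = a 0 i -> f (x + L 0 i *: delta_mx 0 i) = f x) ->
  avg n (partial i f) @[n --> \oo] --> 0.
Proof.
set e := delta_mx 0 i => df cf ffaces.
apply/cvgrPdist_le => /= eps eps0.
(* Compactness of the box makes the continuity uniform. The shifted point [x + t *: e] may leave the
   box, but [partial i f] is continuous there too. *)
have unif : \forall t \near (0 : R),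
    box `<=` [set x | `|partial i f (x + t *: e) - partial i f x| <= eps].
  have := (compact_near_coveringP box).1 box_compact R (nbhs (0 : R))
    (fun t x => `|partial i f (x + t *: e) - partial i f x| <= eps) _.
  apply=> x _.
  have ct : (partial i f (p.1 + p.2 *: e) - partial i f p.1)
      @[p --> (x, (0 : R))] --> (0 : R).
    rewrite -[X in _ --> X](subrr (partial i f x)); apply: cvgB; last first.
      by apply: (cvg_comp _ _ cvg_fst); exact: cf.
    rewrite -[X in _ --> partial i f X]addr0 -[X in _ --> partial i f (_ + X)](scale0r e).
    apply: (@cvg_comp _ _ _ (fun p : 'rV[R]_d * R => p.1 + p.2 *: e)
      (partial i f)); last exact: cf.
    apply: cvgD; first exact: cvg_fst.
    by apply: cvgZr_tmp; exact: cvg_snd.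
  move/cvgr0_norm_le : ct => /(_ _ eps0).
  by [].
have [delta /= delta0 unifd] := (nbhs_ballP _ _).1 unif.
near=> n.
have n0 : (0 < n)%N by near: n; exact: nbhs_infty_gt.
have nN0 : n%:R != 0 :> R by rewrite pnatr_eq0 -lt0n.
pose h := L 0 i / n%:R.
have h0 : 0 < h by rewrite divr_gt0// ltr0n.
have hd : h < delta.
  rewrite /h ltr_pdivrMr ?ltr0n// -ltr_pdivrMl// mulrC.
  by near: n; exact: nbhs_infty_gtr.
have quot x : box x -> `|partial i f x - (f (x + h *: e) - f x) / h| <= eps.
  move=> bx.
  have [t /andP[t0 th] fth] := partial_MVT (ltW h0) (fun u _ => df (u *: e + x)).
  rewrite [x + _]addrC fth mulfK ?gt_eqF//.
  rewrite distrC [t *: e + x]addrC; apply: unifd => //.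
  rewrite /ball/= sub0r normrN ger0_norm//; exact: le_lt_trans hd.
rewrite sub0r normrN.
have -> : avg n (partial i f) =
    avg n (fun x => partial i f x - (f (x + h *: e) - f x) / h).
  rewrite avgD avgN.
  under [X in _ - X]eq_avg do rewrite mulrC.
  by rewrite avgZ avgD avgN avg_shift// subrr mulr0 subr0.
apply: (le_trans (ler_norm_avg _ _)).
by rewrite -[leRHS](@avg_cst n)//; exact: le_avg.
Unshelve. all: by end_near. Qed.

Lemma avg_divergence (w : 'I_d -> 'rV[R]_d -> R) :
  (forall i x, derivable (w i) x (delta_mx 0 i)) ->
  (forall i, continuous (partial i (w i))) ->
  (forall i (x : 'rV[R]_d), x 0 i = a 0 i ->
    w i (x + L 0 i *: delta_mx 0 i) = w i x) ->
  avg n (fun x => \sum_i partial i (w i) x) @[n --> \oo] --> 0.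
Proof.
move=> dw cw wfaces; under eq_fun do rewrite avg_sum.
have := @cvg_sumr R R nat 'I_d \oo _ (index_enum 'I_d) xpredT
  (fun i n => avg n (partial i (w i))) (fun=> 0).
by rewrite big1//; apply=> i _; apply: avg_partial => // x; exact: wfaces.
Qed.

Lemma eq_modn_near m (p q : nat) : p = q %[mod m] ->
  `|p%:R - q%:R : R| < m%:R -> p = q.
Proof.
wlog pq : p q / (p <= q)%N => [hw|] pqm pq_lt.
  have [/hw|/ltnW/hw] := leqP p q; first exact.
  by move=> h; apply/esym; apply: h; rewrite // distrC.
move: pq_lt; rewrite distrC -natrB// normr_nat ltr_nat => qp.
apply/eqP; rewrite eqn_leq pq/= -subn_eq0 -(modn_small qp).
by rewrite -/(_ %| _)%N -eqn_mod_dvd// pqm.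
Qed.

(** Grid points on a line parallel to the [i]-th axis have spacing [L 0 i / n], so at most
    [c * n / L 0 i + 1] of them lie in [T], and there are [n ^ (d - 1)] such lines. *)
Lemma avg_thin n (T : set 'rV[R]_d) i (c : R) : (0 < n)%N -> 0 <= c ->
  (forall x y, T x -> T y -> (forall j, j != i -> x 0 j = y 0 j) ->
    `|x 0 i - y 0 i| <= c) ->
  avg n \1_T <= c / L 0 i + n%:R^-1.
Proof.
move=> n0 c0 thin; have Li := L0 i.
have nR0 : 0 < n%:R :> R by rewrite ltr0n.
pose m := Num.truncn (c * n%:R / L 0 i).
have m_le : m%:R <= c * n%:R / L 0 i.
  by rewrite truncn_le// divr_ge0// ?mulr_ge0// ltW.
have m_lt : c * n%:R / L 0 i < m.+1%:R by exact: truncnS_gt.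
pose S := [set z : {ffun 'I_d -> 'I_n} | gridpt z \in T]%SET.
have -> : avg n \1_T = (n%:R ^+ d)^-1 * #|S|%:R.
  rewrite /avg; congr (_ * _).
  transitivity (\sum_(z : {ffun 'I_d -> 'I_n}) (z \in S : nat)%:R : R).
    by apply: eq_bigr => z _; rewrite inE indicE.
  by rewrite -natr_sum; congr (_%:R); rewrite -big_mkcond sum1_card.
have S_le : (#|S| <= m.+1 * n ^ d.-1)%N.
  (* Grid points of [T] on a line parallel to the [i]-th axis are less than
     [m.+1] steps apart, hence separated by their index modulo [m.+1]. *)
  pose phi (z : {ffun 'I_d -> 'I_n}) : 'I_m.+1 * {ffun 'I_d.-1 -> 'I_n} :=
    (inord (z i %% m.+1), [ffun j => z (lift i j)]).
  rewrite -[X in (X * _)%N](card_ord m.+1).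
  rewrite -[X in (X ^ _)%N](card_ord n) -[X in (_ ^ X)%N](card_ord d.-1).
  rewrite -card_ffun -card_prod.
  apply: (@leq_card_in _ _ phi) => z z'; rewrite !inE => Sz Sz' [] Hi Hj.
  have eqj j : j != i -> z j = z' j.
    rewrite eq_sym => /unlift_some[k -> _].
    by move/ffunP: Hj => /(_ k); rewrite !ffunE.
  have : `|(gridpt z) 0 i - (gridpt z') 0 i| <= c.
    by apply: thin; rewrite ?inE in Sz Sz' * => // j /eqj zj; rewrite !mxE zj.
  rewrite !mxE opprD addrACA subrr add0r -mulrBr -mulrBl normrM.
  rewrite gtr0_norm// normrM (gtr0_norm (x := n%:R^-1)) ?invr_gt0//.
  rewrite -ler_pdivlMl// ler_pdivrMr// => zz'.
  have zm : `|(z i)%:R - (z' i)%:R : R| < m.+1%:R.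
    by apply: le_lt_trans m_lt; rewrite [leRHS]mulrC mulrA.
  apply/ffunP => j; have [->|/eqj//] := eqVneq j i; apply/val_inj => /=.
  apply: (@eq_modn_near m.+1) => //.
  by have := congr1 val Hi; rewrite /= !inordK// ltn_mod.
have d0 : (0 < d)%N by case: d i {thin Li m m_le m_lt S S_le} => [[]|].
rewrite ler_pdivrMl ?exprn_gt0//.
apply: (@le_trans _ _ (m.+1 * n ^ d.-1)%:R); first by rewrite ler_nat.
rewrite -[in n%:R ^+ d](prednK d0) exprS natrM natrX mulrAC.
rewrite ler_wpM2r ?exprn_ge0// mulrDr divff ?gt_eqF// -natr1 lerD2r.
by rewrite mulrA [n%:R * c]mulrC.
Qed.

(* Any ball meeting the box contains a cell of a coarse grid, whose share of
   the points of the finer grids is constant. *)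
Lemma avg_ball x0 (r : R) : box x0 -> (forall i, x0 0 i < a 0 i + L 0 i) ->
  0 < r -> exists b N, [/\ 0 < b, (0 < N)%N & forall q, (0 < q)%N ->
    b <= avg (N * q) \1_[set x : 'rV[R]_d | forall i, `|x 0 i - x0 0 i| < r]].
Proof.
move=> bx0 ltx0 r0.
(* Fine enough for every side [L 0 i / N] of a coarse cell to be shorter than [r]. *)
pose N := (Num.truncn (\sum_i L 0 i / r)).+1.
have LN i : L 0 i < r * N%:R.
  rewrite mulrC -ltr_pdivrMr//; apply: le_lt_trans (truncnS_gt _).
  rewrite (bigD1 i)//= lerDl; apply: sumr_ge0 => j _.
  by rewrite divr_ge0// ltW.
have N0 : 0 < N%:R :> R by rewrite ltr0n.
exists (N%:R ^+ d)^-1, N; split=> //; first by rewrite invr_gt0 exprn_gt0.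
pose u i := N%:R * ((x0 0 i - a 0 i) / L 0 i).
have u0 i : 0 <= u i.
  by rewrite mulr_ge0// divr_ge0 ?(ltW (L0 i))// subr_ge0; case/andP: (bx0 i).
have uN i : u i < N%:R.
  by rewrite /u gtr_pMr// ltr_pdivrMr ?L0// mul1r ltrBlDl.
(* [c] is the index of the coarse cell containing [x0]; the strict upper bound on [x0] gives
   [c i < N]. The points of the finer grid in this cell have the indices [c i * q + y] with
   [y < q]. *)
pose c i := Num.truncn (u i).
have cu i : (c i)%:R <= u i by rewrite truncn_le.
have cN i : (c i < N)%N.
  by rewrite -(ltr_nat R); exact: le_lt_trans (uN i).
move=> q q0; set B := [set x : 'rV[R]_d | _].
have qR0 : 0 < q%:R :> R by rewrite ltr0n.
have lt_emb i (y : 'I_q) : (c i * q + y < N * q)%N.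
  by apply: (@leq_trans ((c i).+1 * q)); rewrite ?leq_pmul2r// mulSn addnC ltn_add2r.
pose emb (y : {ffun 'I_d -> 'I_q}) : {ffun 'I_d -> 'I_(N * q)} :=
  [ffun i => Ordinal (lt_emb i (y i))].
have emb_inj : injective emb.
  move=> y y' /ffunP yy'; apply/ffunP => i; apply/val_inj.
  have := congr1 val (yy' i); rewrite !ffunE/= => /eqP.
  by rewrite eqn_add2l => /eqP.
have embB y : B (gridpt (emb y)).
  move=> i; rewrite !mxE ffunE/= natrD !natrM.
  have -> : (c i)%:R * q%:R + (y i)%:R = ((c i)%:R + (y i)%:R / q%:R) * q%:R :> R.
    by field; rewrite gt_eqF.
  rewrite -mulf_div divff ?gt_eqF// mulr1.
  set v := _ + _ / _.
  have -> : a 0 i + L 0 i * (v / N%:R) - x0 0 i = L 0 i / N%:R * (v - u i).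
    by rewrite /u; field; rewrite !gt_eqF ?L0.
  have Lr : L 0 i / N%:R < r by rewrite ltr_pdivrMr.
  have vu : `|v - u i| <= 1.
    have := cu i; have := truncnS_gt (u i); rewrite -natr1 -/(c i).
    have : 0 <= ((y i)%:R / q%:R : R) < 1.
      by rewrite divr_ge0//= ltr_pdivrMr// mul1r ltr_nat.
    by rewrite /v => /andP[*]; rewrite ler_norml; apply/andP; split; lra.
  have LN0 : 0 < L 0 i / N%:R by rewrite divr_gt0.
  rewrite normrM (gtr0_norm LN0); apply: le_lt_trans Lr.
  by rewrite ler_piMr// ltW.
rewrite /avg natrM exprMn invfM -mulrA -[leLHS]mulr1 ler_wpM2l ?invr_ge0 ?exprn_ge0//.
rewrite ler_pdivlMl ?exprn_gt0// mulr1.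
have -> : q%:R ^+ d = \sum_(y : {ffun 'I_d -> 'I_q}) \1_B (gridpt (emb y)) :> R.
  under eq_bigr do rewrite indicE mem_set//.
  by rewrite sumr_const card_ffun !card_ord natrX.
rewrite -(big_imset (fun z => \1_B (gridpt z)))/=; last by move=> ? ? _ _ /emb_inj.
rewrite [leRHS](bigID [in [set emb y | y in xpredT]%SET])/=.
by rewrite lerDl; apply: sumr_ge0 => z _; rewrite indicE.
Qed.

End grid_average.

(** * Negligible sets *)

Definition advect (R : realType) (d : nat) (v : 'rV[R]_d -> 'rV[R]_d)
    (f : 'rV[R]_d -> R) (x : 'rV[R]_d) : R :=
  \sum_i v x 0 i * partial i f x.

Section negligible_cutoffs.
Context {R : realType} {d : nat}.
Variables a L : 'rV[R]_d.
Hypothesis L0 : forall i, 0 < L 0 i.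
Variables (Omega : set 'rV[R]_d) (v : 'rV[R]_d -> 'rV[R]_d).
Implicit Types (f g eta : 'rV[R]_d -> R) (S U W : set 'rV[R]_d).

Lemma advectM f g x : (forall i, derivable f x (delta_mx 0 i)) ->
  (forall i, derivable g x (delta_mx 0 i)) ->
  advect v (fun y => f y * g y) x = f x * advect v g x + g x * advect v f x.
Proof.
move=> df dg; rewrite /advect !mulr_sumr -big_split/=; apply: eq_bigr => i _.
by rewrite (partialM (df i) (dg i)); ring.
Qed.

Lemma advectZ c f x : (forall i, derivable f x (delta_mx 0 i)) ->
  advect v (fun y => c * f y) x = c * advect v f x.
Proof.
move=> df; rewrite (@advectM (fun=> c) f x (fun i => derivable_cst _ _ _) df).
rewrite [X in _ + _ * X](_ : _ = 0) ?mulr0 ?addr0//.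
by rewrite /advect big1// => i _; rewrite partial_cst mulr0.
Qed.

Lemma advect1B f x : (forall i, derivable f x (delta_mx 0 i)) ->
  advect v (fun y => 1 - f y) x = - advect v f x.
Proof.
move=> df; rewrite /advect -sumrN; apply: eq_bigr => i _.
rewrite (@partialD _ _ (fun=> 1) (fun y => - f y)); last 2 first.
- exact: derivable_cst.
- exact: derivableN.
by rewrite partial_cst add0r (partialN (df i)) mulrN.
Qed.

Lemma advect_comp (k dk : R -> R) f x : is_derive (f x) 1 k (dk (f x)) ->
  (forall i, derivable f x (delta_mx 0 i)) ->
  advect v (fun y => k (f y)) x = dk (f x) * advect v f x.
Proof.
move=> kd df; rewrite /advect mulr_sumr; apply: eq_bigr => i _.
by have [_ /= kf] := partial_comp kd (df i); rewrite /partial kf mulrCA.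
Qed.

Lemma eq_near_advect f g x : {near x, f =1 g} -> advect v f x = advect v g x.
Proof.
by move=> fg; apply: eq_bigr => i _; rewrite (eq_near_partial i fg).
Qed.

Lemma advect_cst c x : advect v (fun=> c) x = 0.
Proof. by rewrite /advect big1// => i _; rewrite partial_cst mulr0. Qed.

(* Cutting off [S] with such an [eta] costs arbitrarily little in the weak
   form of the divergence theorem. *)
Definition negligible S : Prop := forall eps : R, 0 < eps -> exists eta,
  [/\ pC1 setT eta, forall x, 0 <= eta x <= 1,
      \forall n \near \oo,
        avg a L n (fun x => \1_Omega x * (1 - eta x + `|advect v eta x|)) <= eps
    & forall y, S y -> \forall z \near y, Omega z -> eta z = 0].

Lemma negligibleS S S' : S `<=` S' -> negligible S' -> negligible S.
Proof.
move=> SS' nS eps /nS[eta [? ? ? etaS]]; exists eta; split=> // y /SS'.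
exact: etaS.
Qed.

Lemma negligible0 : negligible set0.
Proof.
move=> eps eps0; exists (fun=> 1); split=> //.
- exact: pC1_cst.
- by move=> x; rewrite ler01 lexx.
apply: nearW => n; rewrite (@eq_avg _ _ _ _ L0 n _ (fun=> 0)) ?avg0 ?ltW// => x _.
by rewrite advect_cst normr0 subrr addr0 mulr0.
Qed.

(** The product of the two cutoffs works: [1 - e * e'] is at most [(1 - e) + (1 - e')], and by the
    Leibniz rule its derivative along [v] is bounded by the sum of the two, as both factors lie in
    [0, 1]. *)
Lemma negligibleU S S' : negligible S -> negligible S' -> negligible (S `|` S').
Proof.
move=> nS nS' eps eps0.
have eps2 : 0 < eps / 2 by rewrite divr_gt0.
have [e [Ce e01 en eS]] := nS _ eps2; have [e' [Ce' e01' en' eS']] := nS' _ eps2.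
exists (fun x => e x * e' x); split.
- by apply: pC1M => //; exact: openT.
- move=> x; have /andP[? ?] := e01 x; have /andP[? ?] := e01' x.
  by rewrite mulr_ge0//= mulr_ile1.
- apply: filterS2 en en' => n n1 n2; rewrite [leRHS](splitr eps).
  apply: le_trans (lerD n1 n2); rewrite -avgD; apply: le_avg => // x _.
  rewrite -mulrDr; apply: ler_wpM2l; first by rewrite indicE.
  rewrite advectM; last 2 first.
  - by move=> i; case: ((Ce x I).2 i).
  - by move=> i; case: ((Ce' x I).2 i).
  have := e01 x; have := e01' x => /andP[a0 a1] /andP[b0 b1].
  apply: (@le_trans _ _ (1 - e x + (1 - e' x) +
    (`|advect v e x| + `|advect v e' x|))); last by lra.
  apply: lerD; first by nra.
  apply: (le_trans (ler_normD _ _)); rewrite !normrM addrC.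
  by apply: lerD; rewrite ger0_norm// ler_piMl.
- move=> y [/eS|/eS']; apply: filterS => z /[apply] ->; by rewrite ?mul0r ?mulr0.
Qed.

Lemma negligible_bigcup (T : eqType) (s : seq T) (S : T -> set 'rV[R]_d) :
  (forall t, t \in s -> negligible (S t)) ->
  negligible [set x | exists2 t, t \in s & S t x].
Proof.
elim: s => [_|t s IH nS].
  by apply: (negligibleS _ negligible0) => x [].
have nSt : negligible (S t) by apply: nS; rewrite mem_head.
have nSs : negligible [set x | exists2 t, t \in s & S t x].
  by apply: IH => u us; apply: nS; rewrite inE us orbT.
apply: (negligibleS _ (negligibleU nSt nSs)) => x [u].
by rewrite inE => /orP[/eqP ->|us] Sux; [left|right; exists u].
Qed.

End negligible_cutoffs.

(** * The boundary layer of one chart function *)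

Section boundary_layer.
Context {R : realType} {d : nat}.
Variables a L : 'rV[R]_d.
Hypothesis L0 : forall i, 0 < L 0 i.
Variables (Omega : set 'rV[R]_d) (v : 'rV[R]_d -> 'rV[R]_d).
Hypothesis v_continuous : forall i y, closure Omega y ->
  v z 0 i @[z --> within (closure Omega) (nbhs y)] --> v y 0 i.
Variable M : R.
Hypothesis v_bounded : forall i y, closure Omega y -> `|v y 0 i| <= M.

Definition cube (x : 'rV[R]_d) (r : R) : set 'rV[R]_d :=
  [set y | forall i, `|y 0 i - x 0 i| <= r].

Lemma cube_compact x r : compact (cube x r).
Proof.
have : compact [set y : 'rV[R]_d |
    forall i, [set` `[x 0 i - r, x 0 i + r]] (y 0 i)].
  apply: (@rV_compact R d (fun i => [set` `[x 0 i - r, x 0 i + r]])) => i.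
  exact: segment_compact.
congr compact; apply/seteqP; split=> y /= xy i; have := xy i.
  by rewrite in_itv/= ler_distl.
by rewrite in_itv/= ler_distl.
Qed.

Lemma nbhs_cube x (P : set 'rV[R]_d) : nbhs x P ->
  exists2 r : R, 0 < r & cube x r `<=` P.
Proof.
move=> /nbhs_ballP[r /= r0 rP]; exists (r / 2); first by rewrite divr_gt0.
move=> y xy; apply: rP; split=> // i j; rewrite (ord1 i) /ball/=.
by rewrite distrC (le_lt_trans (xy j))// ltr_pdivrMr// ltr_pMr// ltr1n.
Qed.

Lemma cube_nbhs x (r : R) : 0 < r -> nbhs x (cube x r).
Proof.
move=> r0; apply/nbhs_ballP; exists r => //= y [_ xy] i.
by have := xy 0 i; rewrite /ball/= distrC => /ltW.
Qed.

(** The squared Euclidean distance in units of [r]: unlike the norm behind [cube] it is C^1, so it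
    can be fed to [cutoff]. *)
Definition sqdist (x : 'rV[R]_d) (r : R) (y : 'rV[R]_d) : R :=
  \sum_i (r^-1 * (y 0 i + - x 0 i)) * (r^-1 * (y 0 i + - x 0 i)).

Lemma pC1_sqdist U x r : open U -> pC1 U (sqdist x r).
Proof.
move=> oU; apply: pC1_sum => // i.
have lin : pC1 U (fun y : 'rV[R]_d => r^-1 * (y 0 i + - x 0 i)).
  apply: pC1M => //; first exact: pC1_cst.
  exact: (pC1D oU (@pC1_coord _ _ _ i) (@pC1_cst _ _ _ _)).
exact: (pC1M oU lin lin).
Qed.

(** The factor of [r] is the square root of 2 rounded up. *)
Lemma sqdist_cube x (r : R) y : 0 < r -> sqdist x r y <= 2 -> cube x (2 * r) y.
Proof.
move=> r0 q2 i.
have : (r^-1 * (y 0 i - x 0 i)) ^+ 2 <= 2.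
  apply: le_trans q2; rewrite /sqdist (bigD1 i)//= expr2 lerDl.
  by apply: sumr_ge0 => j _; rewrite -expr2 sqr_ge0.
rewrite -real_normK ?num_real// normrM normfV (gtr0_norm r0).
set t := `|_|; have t0 : 0 <= t by exact: normr_ge0.
rewrite mulrC -ler_pdivrMr//.
have : 0 <= r^-1 * t by rewrite mulr_ge0// invr_ge0 ltW.
by rewrite mulrC; nra.
Qed.

Lemma sqdist0 x r : sqdist x r x = 0.
Proof. by rewrite /sqdist big1// => i _; rewrite subrr mulr0 mul0r. Qed.

Lemma bounded_on_cube (f : 'rV[R]_d -> R) U x r : pC1 U f -> cube x r `<=` U ->
  forall i, exists C, forall y, cube x r y -> `|partial i f y| <= C.
Proof.
move=> fU xU i.
have : compact (partial i f @` cube x r).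
  apply: continuous_compact; last exact: cube_compact.
  apply: continuous_in_subspaceT => y /set_mem /xU Uy.
  by case: ((fU _ Uy).2 i).
move=> /compact_bounded[C [Creal CB]].
exists (C + 1) => y xy; apply: (CB (C + 1)); first by rewrite ltrDl.
by exists y.
Qed.

Section chart_function.
Variables (U : set 'rV[R]_d) (g : 'rV[R]_d -> R) (x : 'rV[R]_d) (j : 'I_d).
Hypotheses (oU : open U) (Ux : U x) (gU : pC1 U g).
Hypothesis gj : partial j g x != 0.
Hypothesis g_le0 : forall y, U y -> Omega y -> g y < 0.
Hypothesis g_tangent : forall y, U y -> closure Omega y -> g y = 0 ->
  advect v g y = 0.

Lemma chart_cube : exists r : R, [/\ 0 < r, cube x (2 * r) `<=` U &
  forall y, cube x (2 * r) y -> `|partial j g x| / 2 <= `|partial j g y|].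
Proof.
have gj0 : 0 < `|partial j g x| by rewrite normr_gt0.
have nearx : \forall y \near x,
    U y /\ `|partial j g x| / 2 <= `|partial j g y|.
  near=> y; split; first by near: y; exact: open_nbhs_nbhs.
  have : `|partial j g x - partial j g y| <= `|partial j g x| / 2.
    near: y; have [_ /cvgrPdist_le] := (gU Ux).2 j; apply.
    by rewrite divr_gt0.
  have := lerB_dist (partial j g x) (partial j g y); lra.
have [r r0 rP] := nbhs_cube nearx.
exists (r / 2); have -> : 2 * (r / 2) = r by field.
split; first by rewrite divr_gt0.
  by move=> y /rP[].
by move=> y /rP[].
Unshelve. all: by end_near. Qed.

(** Compactness makes a pointwise alternative uniform. At a point where [g] vanishes, tangency and
    continuity within the closure make v.grad g small nearby; at any other point [g] stays away from
    0, so the layer is empty nearby once [delta] is small. *)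
Lemma advect_small r (w : R) : cube x r `<=` U -> 0 < w ->
  exists2 delta, 0 < delta & forall y, cube x r y -> Omega y ->
    `|g y| < delta -> `|advect v g y| <= w.
Proof.
move=> rU w0.
have cK : compact (closure Omega `&` cube x r).
  rewrite setIC; apply: compact_closedI; first exact: cube_compact.
  exact: closed_closure.
have := (near_covering_withinP _).2 ((compact_near_coveringP _).1 cK) R 0^'+
  (fun delta y => `|g y| < delta -> `|advect v g y| <= w) _.
case=> [y [cy /rU Uy]|delta0 /= delta0_gt0 smalld].
  have cg := (gU Uy).1.
  have [gy0|gy0] := eqVneq (g y) 0.
    have ca : advect v g z @[z --> within (closure Omega) (nbhs y)] --> (0 : R).
      rewrite -(g_tangent Uy cy gy0); apply: cvg_sumr => i _; apply: cvgM.
        exact: v_continuous.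
      by apply: cvg_within_filter; case: ((gU Uy).2 i).
    move/cvgr0_norm_le : ca => /(_ _ w0); rewrite near_withinE => near1.
    exists ([set z | closure Omega z -> `|advect v g z| <= w], setT).
      by split=> //; exact: filterT.
    by move=> [z delta] /= [cz _] [/cz].
  have gy2 : 0 < `|g y| / 2 by rewrite divr_gt0// normr_gt0.
  exists ([set z | `|g y - g z| <= `|g y| / 2], [set delta | delta < `|g y| / 2]).
    split=> /=; first by move/cvgrPdist_le : cg; exact.
    exact: nbhs_right_lt.
  move=> [z delta] /= [gz dl] _ gzd.
  by have := lerB_dist (g y) (g z); lra.
exists (delta0 / 2); first by rewrite divr_gt0.
move=> y xy Oy; apply: (smalld (delta0 / 2)) => //=.
- by rewrite sub0r normrN gtr0_norm ?divr_gt0// ltr_pdivrMr// ltr_pMr// ltr1n.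
- by rewrite divr_gt0.
- by split=> //; exact: subset_closure.
Qed.

(** The cutoff is [1 - psi * chi], where [psi] localises around [x] and [chi] to the layer. The cost
    at a point of the layer is at most [1 + C1 + 4 * w / delta]: 1 for [1 - eta], [C1] for the
    derivative of [psi], and the last term for that of [chi], since 4 bounds [dcutoff] and [w]
    bounds v.grad g. [C1] is fixed before [eps] and [delta]. *)
Lemma negligible_chart : exists2 W, open_nbhs x W &
  negligible a L Omega v (W `&` [set y | 0 <= g y]).
Proof.
have [r [r0 rU gk]] := chart_cube.
set q := sqdist x r.
have Cq : pC1 setT q by apply: pC1_sqdist; exact: openT.
have cq : continuous q by move=> y; case: (Cq y I).
have qU y : q y <= 2 -> U y by move=> /(sqdist_cube r0)/rU.
exists [set y | q y < 1].
  split; last by rewrite /= /q sqdist0 ltr01.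
  apply: (@open_comp _ _ q [set t | t < 1]); last exact: open_lt.
  by move=> y _; exact: cq.
pose psi y := cutoff (q y).
have Cpsi : pC1 setT psi.
  exact: (pC1_comp openT is_derive_cutoff continuous_dcutoff Cq).
have [C1 C1_ge0 psiC1] : exists2 C1 : R, 0 <= C1 & forall y, cube x (2 * r) y -> Omega y ->
    `|advect v psi y| <= C1.
  have /choice[B psiB] := bounded_on_cube Cpsi (@subsetT _ (cube x (2 * r))).
  exists (`|\sum_i M * B i|) => // y xy Oy; apply: le_trans (ler_norm _).
  apply: (le_trans (ler_norm_sum _ _ _)); apply: ler_sum => i _; rewrite normrM.
  apply: ler_pM => //; last exact: psiB.
  by apply: v_bounded; exact: subset_closure.
move=> eps eps0.
set k := `|partial j g x| / 2.
have k0 : 0 < k by rewrite divr_gt0// normr_gt0.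
(* The layer takes a share of at most [5 * delta / (k * L 0 j)] of the grid: 4 from its width
   [4 * delta / k] along axis [j], 1 from the error [n%:R^-1] for large [n]. Times the cost per
   point this is [K * delta * (1 + C1) + 4 * K * w], and the choices of [w] and [delta] bound each
   term by [eps / 2]. Dividing [delta0] by 3 ensures [2 * delta < delta0]. *)
pose K := 5 / (k * L 0 j).
have K0 : 0 < K by rewrite divr_gt0// mulr_gt0.
pose w := eps / (8 * K).
have w0 : 0 < w by rewrite divr_gt0// mulr_gt0.
have [delta0 delta0_gt0 small] := advect_small rU w0.
have C10 : 0 < 2 * K * (1 + C1) by do 2?apply: mulr_gt0 => //; lra.
pose delta := Num.min (delta0 / 3) (eps / (2 * K * (1 + C1))).
have delta_gt0 : 0 < delta by rewrite lt_min !divr_gt0.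
have delta_le0 : 2 * delta < delta0.
  have : delta <= delta0 / 3 by rewrite ge_min lexx.
  by lra.
have delta_le : delta * (2 * K * (1 + C1)) <= eps.
  by rewrite -ler_pdivlMr// ge_min lexx orbT.
have wdelta0 : 0 <= 4 * w / delta.
  by apply: divr_ge0; [apply: mulr_ge0 => //|]; exact: ltW.
have D0 : 0 <= 1 + C1 + 4 * w / delta by lra.
(* On the domain [g] is negative, so [chi] is 1 where [- g y <= delta] and 0 where
   [2 * delta <= - g y]. *)
pose chi y := cutoff (- delta^-1 * g y).
pose eta y := 1 - psi y * chi y.
have chiU : pC1 U chi.
  have gdU := pC1M oU (@pC1_cst _ _ _ (- delta^-1)) gU.
  exact: (pC1_comp oU is_derive_cutoff continuous_dcutoff gdU).
have oV : open [set y | 2 < q y].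
  apply: (@open_comp _ _ q [set t | 2 < t]); last exact: open_gt.
  by move=> y _; exact: cq.
have etaV y : 2 < q y -> eta y = 1.
  by move=> /ltW qy; rewrite /eta /psi cutoff0// mul0r subr0.
(* [chi] is regular on [U] only, but [psi] vanishes where [2 < q], and this open set together with
   [U] covers the space. *)
have Ceta : pC1 setT eta.
  apply: (@pC1S _ _ _ (U `|` [set y | 2 < q y])).
    by move=> y _; have [/qU|] := leP (q y) 2; [left|right].
  apply: pC1U.
    have psiU : pC1 U psi by exact: pC1S Cpsi.
    exact: (pC1D oU (@pC1_cst _ _ _ 1) (pC1N oU (pC1M oU psiU chiU))).
  by apply: (eq_pC1 oV _ (@pC1_cst _ _ _ 1)) => y /etaV.
pose T := cube x (2 * r) `&` [set y | `|g y| <= 2 * delta].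
have etaT y : Omega y ->
    1 - eta y + `|advect v eta y| <= \1_T y * (1 + C1 + 4 * w / delta).
  move=> Oy.
  have [qy|qy] := ltP 2 (q y).
    rewrite (@eq_near_advect _ _ _ _ (fun=> 1)) ?advect_cst.
      by rewrite etaV// normr0 subrr addr0 mulr_ge0// indicE.
    by apply: filterS (open_nbhs_nbhs (conj oV qy)) => z /etaV.
  have Uy := qU _ qy; have gy := g_le0 Uy Oy.
  have xy := sqdist_cube r0 qy.
  have dpsi i := ((Cpsi y I).2 i).1; have dchi i := ((chiU y Uy).2 i).1.
  have dg i := ((gU Uy).2 i).1.
  rewrite (@advect1B _ _ _ (fun z => psi z * chi z)); last first.
    by move=> i; exact: (derivableM (dpsi i) (dchi i)).
  rewrite normrN (advectM v dpsi dchi) /chi.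
  have -> : advect v (fun y => cutoff (- delta^-1 * g y)) y =
      dcutoff (- delta^-1 * g y) * (- delta^-1 * advect v g y).
    rewrite -(advectZ _ _ dg).
    apply: (@advect_comp _ _ _ _ _ (fun y => - delta^-1 * g y)) => [|i].
      exact: is_derive_cutoff.
    by apply: derivableM (dg i); exact: derivable_cst.
  have [gd|gd] := ltP (2 * delta) `|g y|.
    have t2 : 2 <= - delta^-1 * g y.
      by rewrite mulNr -mulrN mulrC ler_pdivlMr// -ltr0_norm// ltW.
    rewrite dcutoff0// /eta /chi cutoff0// mul0r !mulr0 subr0 mul0r addr0.
    by rewrite normr0 addr0 subrr mulr_ge0// indicE.
  rewrite indicE mem_set// mul1r -[leRHS]addrA.
  have p0 := cutoff_ge0 (q y); have p1 := cutoff_le1 (q y).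
  have c0 := cutoff_ge0 (- delta^-1 * g y); have c1 := cutoff_le1 (- delta^-1 * g y).
  apply: lerD.
    rewrite /eta opprB addrCA subrr addr0.
    by rewrite mulr_ile1.
  apply: (le_trans (ler_normD _ _)); rewrite [leLHS]addrC; apply: lerD.
    rewrite normrM -[leRHS]mul1r; apply: ler_pM => //; last exact: psiC1.
    by rewrite ger0_norm.
  have -> : 4 * w / delta = 1 * (4 * (delta^-1 * w)) by ring.
  rewrite normrM; apply: ler_pM => //; first by rewrite ger0_norm.
  rewrite normrM; apply: ler_pM => //; first exact: dcutoff_bound.
  rewrite normrM normrN (gtr0_norm (x := delta^-1)) ?invr_gt0//.
  apply: ler_wpM2l; first by rewrite invr_ge0 ltW.
  by apply: small => //; exact: le_lt_trans delta_le0.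
exists eta; split=> //.
- move=> y; rewrite /eta subr_ge0 gerBl.
  by apply/andP; split; [apply: mulr_ile1|apply: mulr_ge0];
    rewrite ?cutoff_ge0 ?cutoff_le1.
- near=> n.
  have n0 : (0 < n)%N by near: n; exact: nbhs_infty_gt.
  have nlarge : n%:R^-1 <= delta * (k * L 0 j)^-1.
    have kL0 : 0 < delta * (k * L 0 j)^-1 by rewrite divr_gt0// mulr_gt0.
    rewrite invf_ple ?posrE ?ltr0n//.
    by near: n; exact: nbhs_infty_ger.
  (* On [T] the values of [g] differ by at most [4 * delta], while by the mean value theorem [g]
     changes at rate at least [k] along axis [j]. *)
  have thinT : avg a L n \1_T <= 4 * delta / k / L 0 j + n%:R^-1.
    apply: avg_thin => //.
      by apply: divr_ge0; [apply: mulr_ge0 => //|]; exact: ltW.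
    move=> y z [xy gy] [xz gz] yz.
    wlog yzj : y z xy gy xz gz yz / y 0 j <= z 0 j => [hw|].
      have [/hw|/ltW/hw] := leP (y 0 j) (z 0 j); first exact.
      by rewrite distrC; apply=> // i /yz.
    rewrite distrC ger0_norm ?subr_ge0// (ler_pdivlMr _ _ k0) mulrC.
    have xline u : 0 <= u <= z 0 j - y 0 j ->
        cube x (2 * r) (u *: delta_mx 0 j + y).
      move=> /andP[u0 uz] i; rewrite !mxE/=; have := xy i; have := xz i.
      have [->|ij] := eqVneq i j; last by rewrite mulr0 add0r.
      rewrite !ler_norml mulr1 => /andP[? ?] /andP[? ?].
      by apply/andP; split; lra.
    have [||u /xline xu] := @partial_MVT _ _ g y j (z 0 j - y 0 j) _ _.
    - by rewrite subr_ge0.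
    - by move=> u /xline/rU Uu; case: ((gU Uu).2 j).
    have -> : (z 0 j - y 0 j) *: delta_mx 0 j + y = z.
      apply/rowP => i; rewrite !mxE/=; have [->|ij] := eqVneq i j.
        by rewrite mulr1 subrK.
      by rewrite mulr0 add0r yz.
    move=> gzy; apply: (@le_trans _ _ `|g z - g y|).
      rewrite gzy normrM (ger0_norm (x := z 0 j - y 0 j)) ?subr_ge0//.
      by apply: ler_wpM2r; [rewrite subr_ge0|exact: gk].
    by apply: (le_trans (ler_normB _ _)); rewrite /= in gy gz; lra.
  set D := 1 + C1 + 4 * w / delta in D0 etaT *.
  apply: (@le_trans _ _ (D * avg a L n \1_T)).
    rewrite -avgZ; apply: le_avg => // y _; rewrite mulrC indicE.
    have [/set_mem Oy|_] := boolP (y \in Omega); last first.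
      by rewrite mulr0; apply: mulr_ge0 => //; rewrite indicE.
    by rewrite mulr1 [leRHS]mulrC; exact: etaT.
  apply: (@le_trans _ _ (D * (4 * delta / k / L 0 j + delta * (k * L 0 j)^-1))).
    by apply: ler_wpM2l => //; apply: (le_trans thinT); rewrite lerD2l.
  have -> : D * (4 * delta / k / L 0 j + delta * (k * L 0 j)^-1) =
      (delta * (2 * K * (1 + C1)) + w * (8 * K)) / 2.
    by rewrite /D /K; field; rewrite !gt_eqF.
  have -> : w * (8 * K) = eps by rewrite /w divfK// gt_eqF// mulr_gt0.
  lra.
- move=> y [/= qy gy].
  have Uy : U y by apply: qU; rewrite (le_trans (ltW qy))// ler1n.
  near=> z => _.
  have qz : q z <= 1 by near: z; apply: cvgr_le qy; exact: cq.
  have gz : - delta < g z.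
    near: z; apply: (cvgr_gt (g y)); first exact: (gU Uy).1.
    by rewrite (lt_le_trans _ gy)// oppr_lt0.
  rewrite /eta /psi /chi !cutoff1 ?mulr1 ?subrr//.
  by rewrite mulNr lerNl ler_pdivlMl// mulrN1 ltW.
Unshelve. all: by end_near. Qed.

End chart_function.
End boundary_layer.

(** * Charts and normals at nearby boundary points *)

Section charts.
Context {R : realType} {d : nat}.
Implicit Types (Omega U : set 'rV[R]_d) (x y : 'rV[R]_d).

(** With a fixed right inverse [C] of [B x], the determinant of [B y *m C] is continuous in [y] and
    equals 1 at [x]. *)
Lemma near_row_free m (B : 'rV[R]_d -> 'M[R]_(m, d)) x :
  (forall i j, {for x, continuous (fun y => B y i j)}) ->
  row_free (B x) -> \forall y \near x, row_free (B y).
Proof.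
move=> cB /row_freeP[C BC].
have cdet : (\det (B y *m C)) @[y --> x] --> \det (B x *m C).
  have FF : Filter (nbhs x) by exact: nbhs_filter.
  apply: (cvg_sumr (FF := FF)) => s _; apply: cvgM; first exact: cvg_cst.
  apply: (cvg_prodr (FF := FF)) => i _; under eq_fun do rewrite mxE; rewrite mxE.
  by apply: (cvg_sumr (FF := FF)) => k _; apply: cvgM; [exact: cB|exact: cvg_cst].
have near0 : \forall y \near x, 0 < \det (B y *m C).
  by apply: cvgr_gt cdet _ _; rewrite BC det1.
apply: filterS near0 => y det0; apply/row_freeP.
exists (C *m invmx (B y *m C)); rewrite mulmxA mulmxV// unitmxE unitfE.
by rewrite gt_eqF.
Qed.

Lemma row_free_rowsub m p (f : 'I_p -> 'I_m) (B : 'M[R]_(m, d)) :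
  injective f -> row_free B -> row_free (rowsub f B).
Proof.
move=> f_inj /row_freeP[C BC]; apply/row_freeP; exists (colsub f C).
rewrite mulmx_colsub mul_rowsub_mx BC; apply/matrixP => i k.
by rewrite !mxE (inj_eq f_inj).
Qed.

Lemma closure_chart Omega x m U (g : 'I_m -> 'rV[R]_d -> R) y i :
  boundary_chart Omega x U g -> U y -> closure Omega y -> g i y <= 0.
Proof.
move=> [[oU _] gC _ Og] Uy cy; rewrite leNgt; apply/negP => gy.
have cg : {for y, continuous (g i)}.
  by have [/(_ _ Uy)[dg _] _] := gC i; exact: differentiable_continuous.
have : \forall z \near y, U z /\ 0 < g i z.
  near=> z; split; first by near: z; exact: open_nbhs_nbhs.
  by near: z; exact: (cvgr_gt _ cg).
move=> /cy[z [Oz [Uz gz]]].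
by have := (Og z Uz).1 Oz i; rewrite ltNge ltW.
Unshelve. all: by end_near. Qed.

(* The chart at [x] restricts to a chart at nearby boundary points [y], whose
   functions are those vanishing at [y]. *)
Lemma chart_normal Omega x m U (g : 'I_m -> 'rV[R]_d -> R) :
  boundary_chart Omega x U g -> \forall y \near x, U y /\ (closure Omega y ->
    forall i, g i y = 0 -> boundary Omega y /\
      outward_normal Omega y
        ((Num.sqrt (dotp (grad (g i) y) (grad (g i) y)))^-1 *: grad (g i) y)).
Proof.
move=> ch; have [[oU Ux] gC gfree Og] := ch.
have free_near : \forall y \near x, row_free (\matrix_(i < m) grad (g i) y).
  apply: near_row_free => // i j.
  have [/(_ _ Ux)[_ /(_ j) cg] _] := gC i.
  by apply: eq_near_continuous cg; near=> y; rewrite !mxE.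
near=> y; have Uy : U y by near: y; exact: open_nbhs_nbhs.
have free_y : row_free (\matrix_(i < m) grad (g i) y) by near: y.
split=> // cy i gy0; split.
  split=> // /interior_subset /(Og y Uy).1/(_ i); rewrite gy0 ltxx//.
pose J := [set k | g k y == 0]%SET.
have iJ : i \in J by rewrite inE gy0.
pose f (k : 'I_#|J|) : 'I_m := enum_val k.
(* The functions outside [J] stay negative near [y] and so impose no condition there; those in [J]
   inherit independent gradients. *)
have near_neg : nbhs y [set z | U z /\ forall k, k \notin J -> g k z < 0].
  have neg k : \forall z \near y, k \notin J -> g k z < 0.
    have [kJ|kJ] := boolP (k \in J); first by near=> z.
    have gk : g k y < 0.
      by rewrite lt_neqAle (closure_chart _ ch)// andbT; rewrite inE in kJ.
    have cg : {for y, continuous (g k)}.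
      by have [/(_ _ Uy)[dg _] _] := gC k; exact: differentiable_continuous.
    by near=> z => _; near: z; exact: (cvgr_lt _ cg).
  have negall := @filter_forall _ _ _ (nbhs y) (nbhs_filter y) neg.
  near=> z; split; first by near: z; exact: open_nbhs_nbhs.
  by near: z.
exists #|J|, (interior [set z | U z /\ forall k, k \notin J -> g k z < 0]),
  (fun k => g (f k)), (enum_rank_in iJ i).
split; last by rewrite /f enum_rankK_in.
split.
- by split; [exact: open_interior|exact: near_neg].
- move=> k; split; last by have := enum_valP k; rewrite inE => /eqP.
  by move=> z /interior_subset[Uz _]; have [gCk _] := gC (f k); exact: gCk.
- have := row_free_rowsub (@enum_val_inj _ J) free_y; congr row_free.
  by apply/matrixP => k l; rewrite !mxE.
- move=> z /interior_subset[Uz negz]; split=> [/(Og z Uz).1 + k|negJ]; first exact.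
  apply/(Og z Uz) => k; have [kJ|/negz//] := boolP (k \in J).
  by have := negJ (enum_rank_in kJ k); rewrite /f enum_rankK_in.
Unshelve. all: by end_near. Qed.

Lemma chart_partial_neq0 Omega x m U (g : 'I_m -> 'rV[R]_d -> R) i :
  boundary_chart Omega x U g -> exists j, partial j (g i) x != 0.
Proof.
move=> [_ _ gfree _]; apply/existsP; apply: contraLR gfree => /existsPn pg0.
have pg j : partial j (g i) x = 0 by apply/eqP; have := pg0 j; rewrite negbK.
apply/negP => /row_freeP[C] /matrixP /(_ i i); rewrite !mxE eqxx => /eqP.
rewrite big1 => [|j _]; first by rewrite eq_sym oner_eq0.
by rewrite !mxE pg mul0r.
Qed.

Lemma tangent_advect (v : 'rV[R]_d -> 'rV[R]_d) (g : 'rV[R]_d -> R) y :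
  dotp (v y) ((Num.sqrt (dotp (grad g y) (grad g y)))^-1 *: grad g y) = 0 ->
  advect v g y = 0.
Proof.
set n2 := dotp (grad g y) (grad g y); have -> : dotp (v y) ((Num.sqrt n2)^-1 *: grad g y) =
    (Num.sqrt n2)^-1 * advect v g y.
  by rewrite /dotp /advect mulr_sumr; apply: eq_bigr => i _; rewrite !mxE mulrCA.
have n2_ge0 : forall i, 0 <= grad g y 0 i * grad g y 0 i.
  by move=> i; rewrite -expr2 sqr_ge0.
have [n20|n20] := ltP 0 n2.
  by move/eqP; rewrite mulf_eq0 invr_eq0 gt_eqF ?sqrtr_gt0//= => /eqP.
(* If the gradient vanishes, its normalisation is 0 because the inverse of 0 is 0, and every term of
   [advect] is 0 as well. *)
move=> _; rewrite /advect big1// => i _.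
have : n2 == 0 by rewrite eq_le n20 sumr_ge0.
rewrite psumr_eq0// => /allP/(_ i); rewrite mem_index_enum mxE => /(_ isT)/=.
by rewrite mulf_eq0 orbb => /eqP ->; rewrite mulr0.
Qed.

End charts.

(** * Divergence theorem *)

Section divergence_theorem.
Context {R : realType} {d : nat}.
Implicit Types (Omega : set 'rV[R]_d) (v : 'rV[R]_d -> 'rV[R]_d).

Lemma divE (f : 'I_d -> 'rV[R]_d -> R) v x :
  (forall i, {near x, (fun y => v y 0 i) =1 f i}) ->
  div v x = \sum_i partial i (f i) x.
Proof. by move=> vf; apply: eq_bigr => i _; exact: eq_near_partial. Qed.

Lemma closure_coord_bounded Omega : bounded_set Omega ->
  exists2 M : R, 0 < M & forall x i, closure Omega x -> `|x 0 i| <= M.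
Proof.
move=> [M0 [_ MO]]; exists (`|M0| + 1); first by rewrite ltr_wpDl.
move=> x i; have : closed [set y : 'rV[R]_d | `|y 0 i| <= `|M0| + 1].
  apply: (@closed_comp _ _ (fun y : 'rV[R]_d => `|y 0 i|) [set t | t <= `|M0| + 1]).
    by move=> y _; apply: continuous_comp; [exact: coord_continuous|exact: norm_continuous].
  exact: closed_le.
move=> cl; suff : closure Omega `<=` [set y : 'rV[R]_d | `|y 0 i| <= `|M0| + 1].
  exact.
rewrite [X in _ `<=` X](closure_id _).1//; apply: closure_subset => y Oy /=.
have M01 : M0 < `|M0| + 1 by rewrite (le_lt_trans (ler_norm _))// ltrDl.
apply: le_trans (MO _ M01 _ Oy).
rewrite [leRHS]/Num.Def.normr /= mx_normrE; apply/bigmax_geP; right => /=.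
by exists (0, i).
Qed.

(** The field [eta * v], extended by 0, has a divergence of average o(1) on a box around the domain.
    On the domain this divergence is [c] up to [c * (1 - eta) - v.grad eta], whose average is small
    because the boundary is negligible. *)
Lemma div_const_noflux Omega v (c : R) : bounded_domain Omega ->
  smooth_vector (NoFlux Omega) v -> boundary_condition (NoFlux Omega) v ->
  (forall x, Omega x -> div v x = c) -> c = 0.
Proof.
move=> [oO _ [x0 Ox0] bO charts] sv bc dv.
have [rho rho0 rhoO] := closure_coord_bounded bO.
have cO : compact (closure Omega).
  apply: (@subclosed_compact _ _ (cube 0 rho)); [exact: closed_closure|exact: cube_compact|].
  by move=> y cy i; rewrite mxE subr0; exact: rhoO.
(* The margin 1 keeps the faces of the box away from the closure of the domain, so the cut-off field
   vanishes on them. *)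
pose a : 'rV[R]_d := const_mx (- (rho + 1)).
pose L : 'rV[R]_d := const_mx (2 * (rho + 1)).
have L0 i : 0 < L 0 i by rewrite mxE; lra.
have v_continuous i y : closure Omega y ->
    v z 0 i @[z --> within (closure Omega) (nbhs y)] --> v y 0 i.
  by have [_ /subspace_continuousP] := sv i; apply.
have [M v_bounded] : exists M, forall i y, closure Omega y -> `|v y 0 i| <= M.
  have bnd i : exists C, forall y, closure Omega y -> `|v y 0 i| <= C.
    have [_ cv] := sv i.
    have /compact_bounded[C [_ CB]] := continuous_compact cv cO.
    exists (C + 1) => y cy; apply: (CB (C + 1)); first by rewrite ltrDl.
    by exists y.
  have [C CB] := choice bnd; exists (\sum_i `|C i|) => i y cy.
  apply: (le_trans (CB i y cy)); apply: (le_trans (ler_norm _)).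
  by rewrite (bigD1 i)//= lerDl sumr_ge0.
(* Near [x] a point outside [Omega] has some [g i] nonnegative. Each chart function satisfies the
   tangency condition on its own zero set in the closure, so [negligible_chart] applies to each of
   them. *)
have local x : boundary Omega x -> exists W, open_nbhs x W /\
    negligible a L Omega v (W `\` Omega).
  move=> bx; have [m [U [g ch]]] := charts x bx.
  have [U' [oU' U'x] U'P] : exists2 U', open_nbhs x U' & U' `<=`
      [set y | U y /\ (closure Omega y -> forall i, g i y = 0 ->
         advect v (g i) y = 0)].
    have : nbhs x [set y | U y /\ (closure Omega y -> forall i, g i y = 0 ->
         advect v (g i) y = 0)].
      apply: filterS (chart_normal ch) => y [Uy norm_y]; split=> // cy i gy0.
      have [by_ ny] := norm_y cy i gy0.
      by apply: tangent_advect; exact: bc by_ ny.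
    by rewrite nbhsE.
  have [_ gC _ Og] := ch.
  have each i : exists W, open_nbhs x W /\
      negligible a L Omega v (W `&` [set y | 0 <= g i y]).
    have [j gj] := chart_partial_neq0 i ch.
    have gU' : pC1 U' (g i).
      by apply: pC1S (C1_on_pC1 (gC i).1) => y /U'P[].
    have [||W xW nW] := negligible_chart a L0 v_continuous v_bounded oU' U'x
      gU' gj; last by exists W.
    - by move=> y /U'P[/Og Oy _] /Oy; exact.
    - by move=> y /U'P[_ gn] cy; exact: gn.
  have [W WP] := choice each.
  have : nbhs x [set y | U' y /\ forall i, W i y].
    have nW := @filter_forall _ _ _ (nbhs x) (nbhs_filter x)
      (fun i => open_nbhs_nbhs (WP i).1).
    near=> y; split; last by near: y.
    by near: y; exact: (open_nbhs_nbhs (conj oU' U'x)).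
  rewrite nbhsE => -[V xV VW]; exists V; split=> //.
  have nWg := @negligible_bigcup _ _ _ _ L0 Omega v _ (enum 'I_m)
    (fun i => W i `&` [set y | 0 <= g i y]) (fun i _ => (WP i).2).
  apply: negligibleS nWg => y [/VW[/U'P[Uy _] Wy] nOy] /=.
  apply: contrapT => no; apply: nOy; apply/(Og y Uy) => i; rewrite ltNge.
  apply/negP => gi; apply: no; exists i; first by rewrite mem_enum.
  by split.
have nbnd : negligible a L Omega v (boundary Omega).
  have cb : compact (boundary Omega).
    apply: (@subclosed_compact _ _ (closure Omega)) => //; last by move=> y [].
    rewrite /boundary setDE; apply: closedI; first exact: closed_closure.
    by apply: open_closedC; exact: open_interior.
  have localD x : exists W, boundary Omega x -> open_nbhs x W /\
      negligible a L Omega v (W `\` Omega).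
    have [/local[W WP]|nbx] := pselect (boundary Omega x); first by exists W.
    by exists setT.
  have [W WP] := choice localD.
  have := cb; rewrite compact_cover => /(_ _ (boundary Omega) W)[|x bx|E EP Ecov].
  - by move=> x /WP[[]].
  - by exists x => //; have [[]] := WP x bx.
  have nWb := @negligible_bigcup _ _ _ _ L0 Omega v _ (finmap.enum_fset E)
    (fun x => W x `\` Omega) (fun x xE => (WP x (set_mem (EP x xE))).2).
  apply: negligibleS nWb => y by_; have [x xE Wy] := Ecov y by_.
  by exists x => //; split=> // Oy; case: by_ => _; apply; exact: open_nbhs_nbhs.
apply: contrapT => /eqP c0.
have [r r_gt0 rO] := nbhs_cube (open_nbhs_nbhs (conj oO Ox0)).
have bx0 : box a L x0.
  move=> i; have := rhoO x0 i (subset_closure Ox0).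
  by rewrite !mxE in_itv/= ler_norml => /andP[? ?]; apply/andP; split; lra.
have x0lt i : x0 0 i < a 0 i + L 0 i.
  have := rhoO x0 i (subset_closure Ox0).
  by rewrite !mxE ler_norml => /andP[? ?]; lra.
have [b [N [b0 N0 bN]]] := avg_ball L0 bx0 x0lt r_gt0.
have avgO q : (0 < q)%N -> b <= avg a L (N * q) \1_Omega.
  move=> q0; apply: le_trans (bN q q0) _; apply: le_avg => // y _.
  rewrite !indicE ler_nat; have [/set_mem yB|_] := boolP (y \in _) => //.
  by rewrite mem_set//; apply: rO => i; exact/ltW/yB.
have cn0 : 0 < `|c| by rewrite normr_gt0.
(* The cutoff will cost [(|c| + 1) * eps], that is [|c| * b / 4]; with another [|c| * b / 4] for the
   average of the divergence, the total [|c| * b / 2] stays below the lower bound [|c| * b]. *)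
pose eps := `|c| * b / (4 * (`|c| + 1)).
have eps0 : 0 < eps by rewrite divr_gt0 ?mulr_gt0// ltr_wpDl.
have [eta [Ceta eta01 eta_avg eta_bnd]] := nbnd _ eps0.
pose w i y := \1_Omega y * (eta y * v y 0 i).
have w_bnd y i : boundary Omega y -> \forall z \near y, w i z = 0.
  move=> /eta_bnd; apply: filterS => z etaz; rewrite /w indicE.
  have [/set_mem/etaz ->|_] := boolP (z \in Omega); last by rewrite mul0r.
  by rewrite mul0r mulr0.
have w_out y i : ~ Omega y -> \forall z \near y, w i z = 0.
  move=> nOy; have [cy|ncy] := pselect (closure Omega y).
    by apply: w_bnd; split=> // /interior_subset.
  have oc : open (~` closure Omega) by apply: closed_openC; exact: closed_closure.
  apply: filterS (open_nbhs_nbhs (conj oc ncy)) => z ncz.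
  rewrite /w indicE memNset ?mul0r// => Oz; apply: ncz; exact: subset_closure.
(* Inside [Omega] this is a product. Around every other point [w i] is locally 0: near the boundary
   [eta] vanishes on the inner side and the indicator on the outer one. *)
have Cw i : pC1 setT (w i).
  have CwO : pC1 Omega (w i).
    apply: (eq_pC1 oO (f := fun y => eta y * v y 0 i)).
      by move=> y Oy; rewrite /w indicE mem_set// mul1r.
    exact: (pC1M oO (pC1S (@subsetT _ _) Ceta) (C1_on_pC1 (sv i).1)).
  have CwZ : pC1 (interior [set z | w i z = 0]) (w i).
    apply: (eq_pC1 (@open_interior _ _) _ (@pC1_cst _ _ _ 0)).
    by move=> y /interior_subset ->.
  apply: pC1S (pC1U CwO CwZ) => y _.
  by have [Oy|nOy] := pselect (Omega y); [left|right; exact: w_out].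
have far i (y : 'rV[R]_d) : rho < `|y 0 i| -> w i y = 0.
  move=> rhoy; rewrite /w indicE memNset ?mul0r// => Oy.
  by have := rhoO y i (subset_closure Oy); rewrite leNgt rhoy.
have cvg_w : avg a L n (fun x => \sum_i partial i (w i) x) @[n --> \oo] --> (0 : R).
  apply: avg_divergence => // [i x|i x|i x xa].
  - by case: ((Cw i x I).2 i).
  - by case: ((Cw i x I).2 i).
  rewrite mxE in xa; rewrite !far//.
    by rewrite xa normrN gtr0_norm; lra.
  rewrite !mxE xa !eqxx mulr1.
  have -> : - (rho + 1) + 2 * (rho + 1) = rho + 1 by ring.
  by rewrite gtr0_norm; lra.
have div_w x : c * \1_Omega x = \sum_i partial i (w i) x +
    \1_Omega x * (c * (1 - eta x) - advect v eta x).
  rewrite indicE; have [/set_mem Ox|/negP nOx] := boolP (x \in Omega); last first.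
    rewrite mulr0 mul0r addr0 big1// => i _.
    rewrite (@eq_near_partial _ _ _ (fun=> 0)) ?partial_cst//.
    by apply: w_out => Ox; apply: nOx; exact: mem_set.
  have -> : \sum_i partial i (w i) x = advect v eta x + eta x * c.
    rewrite -(dv x Ox) /advect /div mulr_sumr -big_split/=.
    apply: eq_bigr => i _.
    rewrite (@eq_near_partial _ _ _ (fun y => eta y * v y 0 i)).
      rewrite (partialM ((Ceta x I).2 i).1 ((C1_on_pC1 (sv i).1 Ox).2 i).1).
      by rewrite addrC.
    apply: filterS (open_nbhs_nbhs (conj oO Ox)) => z Oz.
    by rewrite /w indicE mem_set// mul1r.
  by rewrite mul1r mulr1; ring.
have small : 0 < `|c| * b / 4 by rewrite divr_gt0// mulr_gt0.
have : \forall n \near \oo, `|c| * avg a L n \1_Omega <= `|c| * b / 2.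
  near=> n.
  have wn : `|avg a L n (fun x => \sum_i partial i (w i) x)| <= `|c| * b / 4.
    by near: n; move/cvgr0_norm_le : cvg_w; apply.
  have etan : avg a L n (fun x => \1_Omega x * (1 - eta x + `|advect v eta x|)) <= eps.
    by near: n.
  have avg1 : 0 <= avg a L n \1_Omega.
    rewrite -(@avg0 _ _ a L n); apply: le_avg => // x _; rewrite indicE; exact: ler0n.
  rewrite -[X in _ * X](ger0_norm avg1) -normrM -avgZ.
  rewrite (@eq_avg _ _ a L L0 n _ _ (fun x _ => div_w x)) avgD.
  apply: (le_trans (ler_normD _ _)).
  have -> : `|c| * b / 2 = `|c| * b / 4 + (`|c| + 1) * eps.
    by rewrite /eps; field; rewrite gt_eqF// ltr_wpDl.
  apply: (lerD wn).
  apply: (@le_trans _ _ (avg a L n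
    (fun x => `|\1_Omega x * (c * (1 - eta x) - advect v eta x)|))).
    exact: ler_norm_avg.
  apply: (@le_trans _ _ ((`|c| + 1) *
    avg a L n (fun x => \1_Omega x * (1 - eta x + `|advect v eta x|)))).
    rewrite -avgZ; apply: le_avg => // x _; rewrite normrM mulrCA.
    have i0 : 0 <= \1_Omega x :> R by rewrite indicE.
    rewrite (ger0_norm i0); apply: ler_wpM2l => //.
    apply: (le_trans (ler_normB _ _)); rewrite normrM.
    have /andP[e0 e1] := eta01 x; rewrite (ger0_norm (x := 1 - eta x)) ?subr_ge0//.
    have := normr_ge0 (advect v eta x); have := normr_ge0 c; nra.
  by rewrite ler_pM2l// ltr_wpDl.
(* The lower bound [b] concerns multiples of [N]; [N * n0.+1] is one beyond [n0]. *)
move=> [n0 _ nP]; have := nP (N * n0.+1)%N; rewrite /= => /(_ _).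
have le_n : (n0 <= N * n0.+1)%N by rewrite (leq_trans (leqnSn _))// leq_pmull.
move=> /(_ le_n); have := avgO n0.+1 isT.
rewrite -(ler_pM2l cn0) => h1 h2; have := le_trans h1 h2.
have := mulr_gt0 cn0 b0; lra.
Unshelve. all: by end_near. Qed.

Lemma div_const_periodic (L : 'rV[R]_d) v (c : R) : (forall i, 0 < L 0 i) ->
  smooth_vector (Periodic L) v -> (forall x, div v x = c) -> c = 0.
Proof.
move=> L0 sv dv.
have Cv i : pC1 setT (fun y => v y 0 i) by apply: C1_on_pC1; exact: (sv i).1.
have cvg0 : avg 0 L n (div v) @[n --> \oo] --> (0 : R).
  apply: avg_divergence => // [i x|i x|i x _]; last exact: (sv i).2.
    by case: ((Cv i x I).2 i).
  by case: ((Cv i x I).2 i).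
have cvgc : avg 0 L n (div v) @[n --> \oo] --> c.
  apply: cvg_near_cst; near=> n.
  rewrite (_ : div v = fun=> c) ?avg_cst//; last exact/funext.
  by near: n; exact: nbhs_infty_gt.
exact: cvg_unique cvgc cvg0.
Unshelve. all: by end_near. Qed.

End divergence_theorem.

(** * Vanishing gradients and smooth fields on the domain *)

Section geometry_facts.
Context {R : realType} {d : nat}.
Implicit Types (D : geometry R d) (f g : 'rV[R]_d -> R).

Lemma derive_grad0 f (x v : 'rV[R]_d) : differentiable f x -> grad f x = 0 ->
  'D_v f x = 0.
Proof.
move=> df gf; rewrite deriveE// (row_sum_delta v) raddf_sum big1// => i _.
rewrite [LHS]linearZ -deriveE//; have /rowP/(_ i) := gf; rewrite !mxE => pf.
exact: etrans (congr1 (fun t : R^o => v 0 i *: t) pf) (scaler0 _ _).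
Qed.

Lemma cube_const f x r : C1_on (cube x r) f ->
  (forall y, cube x r y -> grad f y = 0) -> forall y, cube x r y -> f y = f x.
Proof.
move=> fC gf y xy; pose v := y - x.
have line (t : R) : 0 <= t <= 1 -> cube x r (t *: v + x).
  move=> /andP[t0 t1] i; rewrite !mxE addrK; apply: le_trans (xy i).
  by rewrite normrM ger0_norm// ler_piMl.
have df (t : R) : 0 <= t <= 1 -> is_derive t 1 (fun t : R => f (t *: v + x)) 0.
  move=> /line xt; rewrite -(derive_grad0 v (fC _ xt).1 (gf _ xt)).
  by apply: is_derive_line; apply: diff_derivable; exact: (fC _ xt).1.
have [t||t _] := @MVT_segment R (fun t => f (t *: v + x)) (fun=> 0) 0 1 ler01.
- by rewrite in_itv/= => /andP[t0 t1]; apply: df; rewrite !ltW.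
- apply: continuous_in_subspaceT => u; rewrite inE/= in_itv/= => /df[dt _].
  by apply: differentiable_continuous; exact/derivable1_diffP.
by rewrite mul0r scale1r scale0r add0r subrK => /subr0_eq.
Qed.

(** By [cube_const] the function is locally constant, so a level set and its complement in [Omega]
    are both open. *)
Lemma connected_const (Omega : set 'rV[R]_d) f : open Omega ->
  connected Omega -> C1_on Omega f -> (forall x, Omega x -> grad f x = 0) ->
  forall x y, Omega x -> Omega y -> f x = f y.
Proof.
move=> oO conO fC gf x y Ox Oy.
have locally_open (P : R -> Prop) : open [set z | Omega z /\ P (f z)].
  rewrite openE => z [Oz Pz].
  have [r r0 rO] := nbhs_cube (open_nbhs_nbhs (conj oO Oz)).
  apply: filterS (cube_nbhs z r0) => u zu; split; first exact: rO.
  rewrite (@cube_const f z r)// => [w /rO/fC//|w /rO/gf//].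
have : [set z | Omega z /\ f z = f x] = Omega.
  apply: conO.
  - by exists x.
  - exists [set z | Omega z /\ f z = f x]; first exact: (locally_open (eq^~ (f x))).
    by apply/seteqP; split=> [z [? ?]|z [? []]].
  - exists (~` [set z | Omega z /\ f z <> f x]).
      by apply: open_closedC; exact: (locally_open (fun t => t <> f x)).
    apply/seteqP; split=> [z [Oz zx]|z [Oz nz]]; first by split=> // -[].
    by split=> //; apply: contrapT => zx; apply: nz.
by move=> E; have : Omega y by []; rewrite -E => -[].
Qed.

Lemma points_open D : geometry_ok D -> open (points D).
Proof. by case: D => [L _|Omega []] //=; exact: openT. Qed.

Lemma points_nonempty D : geometry_ok D -> points D !=set0.
Proof. by case: D => [L _|Omega []] //=; exists 0. Qed.

Lemma points_const D f : geometry_ok D -> C1_on (points D) f ->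
  (forall x, points D x -> grad f x = 0) ->
  forall x y, points D x -> points D y -> f x = f y.
Proof.
case: D => [L _ fC gf x y _ _|Omega [oO conO _ _ _] fC gf]; last exact: connected_const.
(* Periodic fields live on the whole space, where a cube around [x] large enough to contain [y]
   suffices. *)
apply/esym; apply: (@cube_const f x (\sum_i `|y 0 i - x 0 i|)) => [z _|z _|i].
- exact: fC.
- exact: gf.
- by rewrite (bigD1 i)//= lerDl sumr_ge0.
Qed.

Lemma div_const D v (c : R) : geometry_ok D -> smooth_vector D v ->
  boundary_condition D v -> (forall x, points D x -> div v x = c) -> c = 0.
Proof.
case: D => [L L0 sv _ dv|Omega bO sv bc]; last exact: div_const_noflux.
by apply: (div_const_periodic L0 sv) => x; exact: dv.
Qed.

Lemma C1_onP U f :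
  C1_on U f <-> (forall x, U x -> differentiable f x) /\ pC1 U f.
Proof.
split=> [fU|[df fU] x Ux]; first by split; [move=> x /fU[]|exact: C1_on_pC1].
by split=> [|i]; [exact: df|case: ((fU x Ux).2 i)].
Qed.

Lemma smooth_cst D (c : R) : smooth_scalar D (fun=> c).
Proof.
split; first by apply/C1_onP; split; [move=> x _; exact: differentiable_cst|exact: pC1_cst].
by case: D => [//|Omega] x; exact: cvg_cst.
Qed.

Lemma smoothD D f g : geometry_ok D -> smooth_scalar D f ->
  smooth_scalar D g -> smooth_scalar D (fun x => f x + g x).
Proof.
move=> Dok [/C1_onP[df Cf] sf] [/C1_onP[dg Cg] sg]; split.
  apply/C1_onP; split; last exact: (pC1D (points_open Dok) Cf Cg).
  by move=> x Dx; exact: (differentiableD (df x Dx) (dg x Dx)).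
case: D {Dok df Cf dg Cg} sf sg => [L|Omega] sf sg x.
  by move=> i; rewrite sf sg.
exact: (continuousD (sf x) (sg x)).
Qed.

Lemma smoothM D f g : geometry_ok D -> smooth_scalar D f ->
  smooth_scalar D g -> smooth_scalar D (fun x => f x * g x).
Proof.
move=> Dok [/C1_onP[df Cf] sf] [/C1_onP[dg Cg] sg]; split.
  apply/C1_onP; split; last exact: (pC1M (points_open Dok) Cf Cg).
  by move=> x Dx; exact: (differentiableM (df x Dx) (dg x Dx)).
case: D {Dok df Cf dg Cg} sf sg => [L|Omega] sf sg x.
  by move=> i; rewrite sf sg.
exact: (continuousM (sf x) (sg x)).
Qed.

Lemma smooth_sum D n (P : pred 'I_n) (F : 'I_n -> 'rV[R]_d -> R) :
  geometry_ok D -> (forall l, smooth_scalar D (F l)) ->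
  smooth_scalar D (fun x => \sum_(l < n | P l) F l x).
Proof.
move=> Dok sF; rewrite [X in smooth_scalar D X](_ : _ =
  \big[(fun f g x => f x + g x)/(fun=> 0)]_(l < n | P l) F l).
  by apply: big_ind => [|f g|l _]; [exact: smooth_cst|exact: smoothD|exact: sF].
apply/funext => x; elim/big_rec2 : _ => // l y f _ <-.
by [].
Qed.

End geometry_facts.

(** * Asymptotic expansions *)

Section right_limits.
Context {R : realType}.

Lemma cvg_eps : (eps : R) @[eps --> 0^'+] --> (0 : R).
Proof. by apply: cvg_within_filter; exact: cvg_id. Qed.

Lemma cvg_expansion1 (a b : R) : (a + eps * b) @[eps --> 0^'+] --> a.
Proof.
rewrite -[X in _ --> X](_ : a + 0 * b = a); last by ring.
by apply: cvgD; [exact: cvg_cst|apply: cvgMr_tmp; exact: cvg_eps].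
Qed.

Lemma cvg_expansion2 (a b c : R) :
  (a + eps * b + eps ^+ 2 * c) @[eps --> 0^'+] --> a.
Proof.
rewrite -[X in _ --> X](_ : a + 0 ^+ 2 * c = a); last by ring.
apply: cvgD; first exact: cvg_expansion1.
by apply: cvgMr_tmp; exact: (cvgM cvg_eps cvg_eps).
Qed.

(** The common coefficients cancel. An error o(1) against terms as large as [eps ^- 2] still
    determines the balances at all three orders. *)
Lemma formally_equal_cvg {V : normedModType R} (F G : R -> V) :
  formally_equal F G -> (F eps - G eps) @[eps --> 0^'+] --> (0 : V).
Proof.
move=> [c2 [c1 [c0 [Fc Gc]]]]; rewrite -(subrr (0 : V)).
apply: cvg_trans (cvgB Fc Gc); apply: near_eq_cvg; near=> eps.
by rewrite /= opprB addrA subrK.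
Unshelve. all: by end_near. Qed.

(* The limits after multiplication by [eps ^+ 2], [eps] and [1] give the balance
   of the coefficients of [eps ^- 2], [eps^-1] and [1]. *)
Lemma stiff_balance n (M : 'I_n -> R -> R) (M0 M1 a b c : 'I_n -> R) (K : R) :
  (forall l, M l eps @[eps --> 0^'+] --> M0 l) ->
  (forall l, (eps^-1 * (M l eps - M0 l)) @[eps --> 0^'+] --> M1 l) ->
  (eps ^- 2 * \sum_l M l eps * (a l + eps * b l + eps ^+ 2 * c l))
    @[eps --> 0^'+] --> K ->
  \sum_l M0 l * a l = 0 /\
  ((forall l eps, M l eps * a l = 0) ->
   K = \sum_l (M1 l * b l + M0 l * c l)).
Proof.
pose S eps := \sum_l M l eps * (a l + eps * b l + eps ^+ 2 * c l).
move=> cM cM1; rewrite -/S => cS.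
have eps_neq0 : \forall eps \near (0 : R)^'+, eps != 0 by exact: nbhs_right_neq.
have ce := cvg_eps.
split.
  have S0 : S eps @[eps --> 0^'+] --> (0 : R).
    rewrite -[X in _ --> X](_ : 0 ^+ 2 * K = 0); last by ring.
    apply: cvg_trans (cvgM (cvgM ce ce) cS); apply: near_eq_cvg.
    near=> eps; have e0 : eps != 0 by near: eps.
    by rewrite /= -expr2 mulVKf// expf_neq0.
  have S1 : S eps @[eps --> 0^'+] --> \sum_l M0 l * a l.
    apply: cvg_sumr => l _; apply: cvgM => //.
    exact: cvg_expansion2.
  exact: cvg_unique S1 S0.
move=> Ma0.
have E1 : \forall eps \near (0 : R)^'+, eps * (eps ^- 2 * S eps) =
    \sum_l M l eps * (b l + eps * c l).
  near=> eps; have e0 : eps != 0 by near: eps.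
  rewrite mulrA /S mulr_sumr; apply: eq_bigr => l _.
  by rewrite -addrA mulrDr Ma0 add0r; field.
have b0 : \sum_l M0 l * b l = 0.
  have T0 : (\sum_l M l eps * (b l + eps * c l)) @[eps --> 0^'+] --> (0 : R).
    rewrite -[X in _ --> X](mul0r K).
    by apply: cvg_trans (cvgM ce cS); exact: near_eq_cvg E1.
  have T1 : (\sum_l M l eps * (b l + eps * c l)) @[eps --> 0^'+] -->
      \sum_l M0 l * b l.
    apply: cvg_sumr => l _; apply: cvgM => //.
    exact: cvg_expansion1.
  exact: cvg_unique T1 T0.
(* Splitting [M] into [M0] and [M - M0] in front of [b] isolates [eps^-1 * \sum_l M0 l * b l], which
   the previous balance removes; the rest converges. *)
have E2 : \forall eps \near (0 : R)^'+, eps ^- 2 * S eps =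
    \sum_l (eps^-1 * (M l eps - M0 l) * b l + M l eps * c l).
  near=> eps; have e0 : eps != 0 by near: eps.
  transitivity (\sum_l (eps^-1 * (M l eps - M0 l) * b l + M l eps * c l) +
      eps^-1 * \sum_l M0 l * b l); last by rewrite b0 mulr0 addr0.
  rewrite /S !mulr_sumr -big_split/=; apply: eq_bigr => l _.
  by rewrite -addrA mulrDr Ma0 add0r; field.
have cS2 : (\sum_l (eps^-1 * (M l eps - M0 l) * b l + M l eps * c l))
    @[eps --> 0^'+] --> \sum_l (M1 l * b l + M0 l * c l).
  by apply: cvg_sumr => l _; apply: cvgD; exact: cvgMr_tmp.
apply: cvg_unique cS _ => //.
apply: cvg_trans cS2; apply: near_eq_cvg; near=> eps; apply/esym.
by near: eps.
Unshelve. all: by end_near. Qed.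

Context {d : nat}.
Implicit Types (x : 'rV[R]_d).

(** Convergence of the values and of one partial derivative at the single point [x] is stable under
    products, and densities, momenta and fluxes are all products of expansions. *)
Definition C1_limit x (i : 'I_d)
    (F : R -> 'rV[R]_d -> R) (F0 : 'rV[R]_d -> R) : Prop :=
  [/\ forall eps, derivable (F eps) x (delta_mx 0 i),
      derivable F0 x (delta_mx 0 i),
      F eps x @[eps --> 0^'+] --> F0 x &
      partial i (F eps) x @[eps --> 0^'+] --> partial i F0 x].

Lemma partial_expansion (f0 f1 f2 : 'rV[R]_d -> R) eps x i :
  derivable f0 x (delta_mx 0 i) -> derivable f1 x (delta_mx 0 i) ->
  derivable f2 x (delta_mx 0 i) ->
  is_derive x (delta_mx 0 i) (fun y => f0 y + eps * f1 y + eps ^+ 2 * f2 y)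
    (partial i f0 x + eps * partial i f1 x + eps ^+ 2 * partial i f2 x).
Proof.
move=> /derivableP d0 /derivableP d1 /derivableP d2.
exact: (is_deriveD (is_deriveD d0 (is_deriveZ eps d1)) (is_deriveZ (eps ^+ 2) d2)).
Qed.

Lemma C1_limit_expansion (f0 f1 f2 : 'rV[R]_d -> R) x i :
  derivable f0 x (delta_mx 0 i) -> derivable f1 x (delta_mx 0 i) ->
  derivable f2 x (delta_mx 0 i) ->
  C1_limit x i (fun eps y => f0 y + eps * f1 y + eps ^+ 2 * f2 y) f0.
Proof.
move=> d0 d1 d2; split; [|exact: d0|exact: cvg_expansion2|].
  by move=> eps; case: (partial_expansion eps d0 d1 d2).
have E : (fun eps => partial i (fun y => f0 y + eps * f1 y + eps ^+ 2 * f2 y) x) =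
    fun eps => partial i f0 x + eps * partial i f1 x + eps ^+ 2 * partial i f2 x.
  by apply/funext => eps; have [_ <-] := partial_expansion eps d0 d1 d2.
by rewrite E; exact: cvg_expansion2.
Qed.

Lemma C1_limitM x i F G F0 G0 : C1_limit x i F F0 -> C1_limit x i G G0 ->
  C1_limit x i (fun eps y => F eps y * G eps y) (fun y => F0 y * G0 y).
Proof.
move=> [dF dF0 cF cF'] [dG dG0 cG cG']; split.
- by move=> eps; exact: (derivableM (dF eps) (dG eps)).
- exact: (derivableM dF0 dG0).
- exact: (cvgM cF cG).
have E : (fun eps => partial i (fun y => F eps y * G eps y) x) =
    fun eps => F eps x * partial i (G eps) x + G eps x * partial i (F eps) x.
  by apply/funext => eps; exact: (partialM (dF eps) (dG eps)).
by rewrite E (partialM dF0 dG0); exact: (cvgD (cvgM cF cG') (cvgM cG cF')).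
Qed.

End right_limits.

(** * Balances of the coefficients in one stage *)

Section stages.
Context {R : realType} {d s : nat}.
Variables (D : geometry R d) (gamma dt : R) (At A : 'M[R]_s.+1).
Hypothesis dt0 : 0 < dt.
Implicit Types (r : ansatz R d R^o) (w : ansatz R d 'rV[R]_d) (x : 'rV[R]_d).

Lemma admissible_derivable r w x i : admissible_state D r w -> points D x ->
  [/\ derivable (order0 r) x (delta_mx 0 i),
      derivable (order1 r) x (delta_mx 0 i) &
      derivable (order2 r) x (delta_mx 0 i)].
Proof.
move=> [[r0 r1 r2] _ _ _] Dx.
by split; apply: diff_derivable; [case: r0|case: r1|case: r2] => /(_ x Dx)[].
Qed.

Lemma density_limit r w x i : admissible_state D r w -> points D x ->
  C1_limit x i (fun eps y => at_eps r eps y) (order0 r).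
Proof.
move=> /admissible_derivable ad Dx; have [d0 d1 d2] := ad x i Dx.
exact: (C1_limit_expansion d0 d1 d2).
Qed.

Lemma velocity_limit r w x i j : admissible_state D r w -> points D x ->
  C1_limit x i (fun eps y => at_eps w eps y 0 j) (fun y => order0 w y 0 j).
Proof.
move=> [_ [w0 w1 w2] _ _] Dx.
rewrite (_ : (fun eps y => _) = fun eps y =>
  order0 w y 0 j + eps * order1 w y 0 j + eps ^+ 2 * order2 w y 0 j); last first.
  by apply/funext => eps; apply/funext => y; rewrite !mxE.
by apply: C1_limit_expansion; apply: diff_derivable;
  [case: (w0 j)|case: (w1 j)|case: (w2 j)] => /(_ x Dx)[].
Qed.

Lemma momentum_limit r w x i j : admissible_state D r w -> points D x ->
  C1_limit x i (fun eps y => momentum r w eps y 0 j)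
    (fun y => order0 r y * order0 w y 0 j).
Proof.
move=> ad Dx; rewrite (_ : (fun eps y => _) = fun eps y =>
  at_eps r eps y * at_eps w eps y 0 j); last first.
  by apply/funext => eps; apply/funext => y; rewrite !mxE.
exact: C1_limitM (density_limit i ad Dx) (velocity_limit i j ad Dx).
Qed.

(** The division cancels and leaves the density times a product of velocities. This identity holds
    at every [eps] and [y]: where the density is 0, so are both sides. *)
Lemma flux_limit r w x i j k : admissible_state D r w -> points D x ->
  C1_limit x i (fun eps y => ((at_eps r eps y)^-1 *:
      tensor (momentum r w eps y) (momentum r w eps y)) k j)
    (fun y => order0 r y * (order0 w y 0 k * order0 w y 0 j)).
Proof.
move=> ad Dx; rewrite (_ : (fun eps y => _) = fun eps y =>
  at_eps r eps y * (at_eps w eps y 0 k * at_eps w eps y 0 j)); last first.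
  apply/funext => eps; apply/funext => y; rewrite !mxE big_ord1 !mxE.
  rewrite -/(at_eps r eps y) -/(at_eps w eps y).
  have [->|r0] := eqVneq (at_eps r eps y) 0; first by rewrite invr0 !mul0r.
  by field.
apply: C1_limitM (density_limit i ad Dx) _.
exact: C1_limitM (velocity_limit i k ad Dx) (velocity_limit i j ad Dx).
Qed.

Definition dpressure (t : R) : R := gamma * t `^ (gamma - 1).

Definition ddpressure (t : R) : R :=
  gamma * ((gamma - 1) * t `^ (gamma - 1 - 1)).

Lemma is_derive_dpressure (t : R) : 0 < t ->
  is_derive t 1 dpressure (ddpressure t).
Proof.
by move=> t0; exact: (is_deriveZ gamma (is_derive1_powR (gamma - 1) t0)).
Qed.

(** Positivity is assumed of [order0 r] only, so the full density at [x] is positive, and the power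
    differentiable there, for small [eps]. *)
Lemma partial_pressure r w x : admissible_state D r w -> points D x ->
  \forall eps \near (0 : R)^'+, forall i,
    partial i (fun y => pressure gamma (at_eps r eps y) - at_eps r eps y) x =
    (dpressure (at_eps r eps x) - 1) * partial i (fun y => at_eps r eps y) x.
Proof.
move=> ad Dx; have pos : 0 < order0 r x by case: ad => _ _ _; apply.
near=> eps => i; have [dr _ cr _] := density_limit i ad Dx.
have r0 : 0 < at_eps r eps x.
  near: eps; apply: (cvgr_gt (order0 r x)) => //.
  exact: cvg_expansion2.
have [dp pE] := @partial_comp R d (fun t => t `^ gamma) dpressure
  (fun y => at_eps r eps y) x i (is_derive1_powR gamma r0) (dr eps).
rewrite (partialD dp (derivableN (dr eps))) (partialN (dr eps)).
by rewrite [X in X + _]pE mulrBl mul1r.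
Unshelve. all: by end_near. Qed.

(** This is the difference quotient at 0 of [dpressure] along the expansion, so the limit is given
    by the chain rule. *)
Lemma dpressure_quotient (a b c : R) : 0 < a ->
  (eps^-1 * (dpressure (a + eps * b + eps ^+ 2 * c) - dpressure a))
    @[eps --> 0^'+] --> ddpressure a * b.
Proof.
move=> a0; pose f (eps : R) := a + eps * b + eps ^+ 2 * c.
have df : is_derive (0 : R) 1 f b.
  have dl : is_derive (0 : R) 1 (fun e : R => a + e * b + e * (e * c)) b.
    by apply: is_derive_eq; rewrite /GRing.scale/=; ring.
  by move: dl; congr is_derive; apply/funext => e; rewrite /f; ring.
have f0 : f 0 = a by rewrite /f; ring.
have : is_derive (0 : R) 1 (dpressure \o f) (ddpressure a * b).
  by apply: is_derive1_comp; rewrite f0; exact: is_derive_dpressure.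
move=> [/cvg_ex[l cl] lE]; have ll : l = ddpressure a * b.
  by rewrite -lE; apply/esym; exact: cvg_lim cl.
move: cl; rewrite ll => cl.
have {cl} cl := cvg_dnbhs_at_right cl.
rewrite (_ : (fun eps => _) = fun h : R => h^-1 *:
  (((dpressure \o f) \o shift 0) (h *: 1) - (dpressure \o f) 0))//.
by apply/funext => h; rewrite /= f0 addr0 [h *: 1]mulr1.
Qed.

Variables (rhon : ansatz R d R^o) (un : ansatz R d 'rV[R]_d).
Variables (rho : 'I_s.+1 -> ansatz R d R^o) (u : 'I_s.+1 -> ansatz R d 'rV[R]_d).
Hypotheses (hn : admissible_state D rhon un)
  (hstages : forall k, admissible_state D (rho k) (u k))
  (At0 : forall i j : 'I_s.+1, (i <= j)%N -> At i j = 0)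
  (A0 : forall i j : 'I_s.+1, (i < j)%N -> A i j = 0).

Lemma mass_balance k x : mass_stage D dt A rhon rho u k -> points D x ->
  order0 (rho k) x = order0 rhon x - dt * \sum_(l < s.+1 | (l <= k)%N) A k l *
    (\sum_i partial i (fun y => order0 (rho l) y * order0 (u l) y 0 i) x).
Proof.
move=> mk Dx; have /formally_equal_cvg := mk x Dx.
set F := fun eps => _; move=> F0.
have F1 : F eps @[eps --> 0^'+] --> (order0 (rho k) x : R^o) - (order0 rhon x -
    dt * \sum_(l < s.+1 | (l <= k)%N) A k l *
    (\sum_i partial i (fun y => order0 (rho l) y * order0 (u l) y 0 i) x) : R^o).
  apply: cvgB; first exact: cvg_expansion2.
  apply: cvgB; first exact: cvg_expansion2.
  apply: cvgMl_tmp; apply: cvg_sumr => l _; apply: cvgMl_tmp.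
  apply: cvg_sumr => i _.
  by have [_ _ _] := momentum_limit i i (hstages l) Dx.
by apply/subr0_eq; exact: cvg_unique F1 F0.
Qed.

(** The factor of [eps ^- 2] times the gradient of the [l]-th density in stage [k], once the chain
    rule has turned the explicit pressure gradient into p' - 1 times a density gradient. *)
Definition stiff_coef k l (t : R) : R := At k l * (dpressure t - 1) + A k l.

(** The equation is divided by [dt] and solved for its stiff terms. All other terms converge, so
    [stiff_balance] applies; the first-order variation of the stiff coefficients comes from that of
    p' along the expansion, and the coefficients with [l > k] vanish. *)
Lemma momentum_balance k x i :
  momentum_stage D gamma dt At A rhon un rho u k -> points D x ->
  \sum_l stiff_coef k l (order0 (rho l) x) * partial i (order0 (rho l)) x = 0 /\
  ((forall l : 'I_s.+1, (l <= k)%N -> partial i (order0 (rho l)) x = 0) ->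
   dt^-1 * (order0 rhon x * order0 un x 0 i - order0 (rho k) x * order0 (u k) x 0 i)
     - \sum_(l < s.+1 | (l < k)%N) At k l * (\sum_j partial j (fun y =>
         order0 (rho l) y * (order0 (u l) y 0 i * order0 (u l) y 0 j)) x) =
   \sum_l (At k l * (ddpressure (order0 (rho l) x) * order1 (rho l) x) *
       partial i (order1 (rho l)) x +
     stiff_coef k l (order0 (rho l) x) * partial i (order2 (rho l)) x)).
Proof.
move=> mk Dx; have := formally_equal_cvg (mk x Dx).
set H := fun eps => _ - _; move=> H0.
have {}H0 : H eps 0 i @[eps --> 0^'+] --> (0 : R).
  have := @coord_continuous R 1 d 0 i 0; rewrite /continuous_at mxE => c0.
  exact: (cvg_comp _ _ H0 c0).
pose flux l eps := \sum_j partial j (fun y => ((at_eps (rho l) eps y)^-1 *: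
  tensor (momentum (rho l) (u l) eps y) (momentum (rho l) (u l) eps y)) i j) x.
pose M l eps := stiff_coef k l (at_eps (rho l) eps x).
pose S eps := \sum_l M l eps * (partial i (order0 (rho l)) x +
  eps * partial i (order1 (rho l)) x + eps ^+ 2 * partial i (order2 (rho l)) x).
have rpos l : 0 < order0 (rho l) x by have [_ _ _] := hstages l; apply.
have nearP : \forall eps \near (0 : R)^'+, forall l j,
    partial j (fun y => pressure gamma (at_eps (rho l) eps y) - at_eps (rho l) eps y) x =
    (dpressure (at_eps (rho l) eps x) - 1) * partial j (fun y => at_eps (rho l) eps y) x.
  by apply: filter_forall => l; exact: partial_pressure (hstages l) Dx.
(* [H], the difference of the two sides, is only known to tend to 0; carrying it along gives an
   exact identity for each small [eps]. *)
have HE : \forall eps \near (0 : R)^'+, dt^-1 * (H eps 0 i +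
    momentum rhon un eps x 0 i - momentum (rho k) (u k) eps x 0 i) -
    \sum_(l < s.+1 | (l < k)%N) At k l * flux l eps = eps ^- 2 * S eps.
  apply: filterS nearP => eps pE.
  have gE l : partial i (fun y => at_eps (rho l) eps y) x =
      partial i (order0 (rho l)) x + eps * partial i (order1 (rho l)) x +
      eps ^+ 2 * partial i (order2 (rho l)) x.
    have [d0 d1 d2] := admissible_derivable i (hstages l) Dx.
    by have [_ <-] := partial_expansion eps d0 d1 d2.
  have -> : H eps 0 i = momentum (rho k) (u k) eps x 0 i -
      (momentum rhon un eps x 0 i
       - dt * \sum_(l < s.+1 | (l < k)%N) At k l * (flux l eps +
          eps ^- 2 * partial i (fun y => pressure gamma (at_eps (rho l) eps y) -
            at_eps (rho l) eps y) x)
       - dt * \sum_(l < s.+1 | (l <= k)%N) A k l *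
          (eps ^- 2 * partial i (fun y => at_eps (rho l) eps y) x)).
    rewrite /H !mxE !summxE; congr (_ - (_ - _ - _)); congr (_ * _).
      by apply: eq_bigr => l _; rewrite !mxE.
    by apply: eq_bigr => l _; rewrite !mxE.
  have -> : \sum_(l < s.+1 | (l < k)%N) At k l * (flux l eps + eps ^- 2 *
      partial i (fun y => pressure gamma (at_eps (rho l) eps y) -
        at_eps (rho l) eps y) x) =
      \sum_(l < s.+1 | (l < k)%N) At k l * flux l eps + eps ^- 2 *
      \sum_l At k l * (dpressure (at_eps (rho l) eps x) - 1) *
        partial i (fun y => at_eps (rho l) eps y) x.
    rewrite (bigID (fun l : 'I_s.+1 => (l < k)%N) xpredT)/=.
    rewrite [X in _ * (_ + X)]big1 ?addr0; last first.
      by move=> l; rewrite -leqNgt => /At0 ->; rewrite !mul0r.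
    rewrite mulr_sumr -big_split/=; apply: eq_bigr => l _.
    by rewrite pE; ring.
  have -> : \sum_(l < s.+1 | (l <= k)%N) A k l *
      (eps ^- 2 * partial i (fun y => at_eps (rho l) eps y) x) =
      eps ^- 2 * \sum_l A k l * partial i (fun y => at_eps (rho l) eps y) x.
    rewrite (bigID (fun l : 'I_s.+1 => (l <= k)%N) xpredT)/=.
    rewrite [X in _ * (_ + X)]big1 ?addr0; last first.
      by move=> l; rewrite -ltnNge => /A0 ->; rewrite mul0r.
    by rewrite mulr_sumr; apply: eq_bigr => l _; rewrite mulrCA.
  have -> : S eps = \sum_l At k l * (dpressure (at_eps (rho l) eps x) - 1) *
        partial i (fun y => at_eps (rho l) eps y) x +
      \sum_l A k l * partial i (fun y => at_eps (rho l) eps y) x.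
    rewrite -big_split; apply: eq_bigr => l _; rewrite /M /stiff_coef gE/=; ring.
  set P := \sum_l _; set Q := \sum_l _; set T := \sum_(l < s.+1 | _) _.
  by move: (eps ^- 2) => e2; field; rewrite gt_eqF.
have cM l : M l eps @[eps --> 0^'+] --> stiff_coef k l (order0 (rho l) x).
  apply: cvgD; last exact: cvg_cst.
  apply: cvgMl_tmp; apply: cvgB; last exact: cvg_cst.
  have [_ _ cr _] := density_limit i (hstages l) Dx.
  have cdp : {for order0 (rho l) x, continuous dpressure}.
    apply: differentiable_continuous; apply/derivable1_diffP.
    by case: (is_derive_dpressure (rpos l)).
  exact: (cvg_comp _ _ cr cdp).
have cM1 l : (eps^-1 * (M l eps - stiff_coef k l (order0 (rho l) x)))
    @[eps --> 0^'+] --> At k l * (ddpressure (order0 (rho l) x) * order1 (rho l) x).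
  rewrite (_ : (fun eps => _) = fun eps => At k l * (eps^-1 *
    (dpressure (at_eps (rho l) eps x) - dpressure (order0 (rho l) x)))).
    apply: cvgMl_tmp; exact: dpressure_quotient.
  by apply/funext => eps; rewrite /M /stiff_coef; ring.
set K := (X in _ -> X = _).
have cK : (eps ^- 2 * S eps) @[eps --> 0^'+] --> K.
  apply: cvg_trans (near_eq_cvg HE) _.
  rewrite /K; apply: cvgB.
    apply: cvgMl_tmp; rewrite -[order0 rhon x * _]add0r.
    apply: cvgB; last by have [_ _ c _] := momentum_limit i i (hstages k) Dx.
    apply: cvgD => //; by have [_ _ c _] := momentum_limit i i hn Dx.
  apply: cvg_sumr => l _; apply: cvgMl_tmp; apply: cvg_sumr => j _.
  by have [_ _ _] := flux_limit j j i (hstages l) Dx.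
have [bal0 bal1] := stiff_balance cM cM1 cK; split=> // gz.
apply: bal1 => l eps; have [lk|kl] := leqP l k; first by rewrite gz// mulr0.
by rewrite /M /stiff_coef At0 ?A0// 1?ltnW// mul0r addr0 mul0r.
Qed.

End stages.

(** * Implicit tableau and induction on the stages *)

Lemma unit_trig_diag (R : realType) n (B : 'M[R]_n) :
  (forall i j : 'I_n, (i < j)%N -> B i j = 0) -> B \in unitmx ->
  forall i, B i i != 0.
Proof.
move=> trigB; rewrite unitmxE unitfE det_trig; last exact/is_trig_mxP.
by move=> /prodf_neq0 B0 i; exact: B0.
Qed.

(** A triangular matrix is invertible only if its diagonal has no zero. For type CK this applies to
    the lower right block, and the remaining row is the zero row of the first stage. *)
Lemma implicit_diag (R : realType) s (A : 'M[R]_s.+1) :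
  (forall i j : 'I_s.+1, (i < j)%N -> A i j = 0) -> type_A A \/ type_CK A ->
  forall k, A k k != 0 \/ k = ord0 /\ forall l, A k l = 0.
Proof.
move=> trigA [uA k|[_ [alpha [As [uAs AE]]]] k]; first by left; exact: unit_trig_diag.
have rE i j : A (rshift 1 i) (rshift 1 j) = As i j.
  exact: etrans (congr1 (fun B : 'M[R]_(1 + s) => B (rshift 1 i) (rshift 1 j)) AE)
    (block_mxEdr _ _ _ _ i j).
have diagAs := unit_trig_diag (fun i j (ij : (i < j)%N) =>
  etrans (esym (rE i j)) (trigA (rshift 1 i) (rshift 1 j) ij)) uAs.
case: (@split_ordP 1 s k) => [i|i] ->; last by left; rewrite rE.
right; split=> [|l]; first by apply: val_inj; rewrite /= ord1.
case: (@split_ordP 1 s l) => [j|j] ->.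
  apply: etrans (congr1 (fun B : 'M[R]_(1 + s) => B (lshift s i) (lshift s j)) AE) _.
  by rewrite block_mxEul mxE.
apply: etrans (congr1 (fun B : 'M[R]_(1 + s) => B (lshift s i) (rshift 1 j)) AE) _.
by rewrite block_mxEur mxE.
Qed.

Lemma eq_limits (R : realType) (F G : R -> R) (p q : R) :
  F eps @[eps --> 0^'+] --> p -> G eps @[eps --> 0^'+] --> q ->
  (F eps - G eps) @[eps --> 0^'+] --> (0 : R) -> p = q.
Proof. by move=> Fp Gq FG; apply/subr0_eq; exact: cvg_unique (cvgB Fp Gq) FG. Qed.

Lemma formally_equal_order0 (R : realType) d (D : geometry R d)
    (r r' : ansatz R d R^o) (w w' : ansatz R d 'rV[R]_d) x :
  admissible_state D r w -> admissible_state D r' w' -> points D x ->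
  formally_equal (fun eps => at_eps r eps x) (fun eps => at_eps r' eps x) ->
  formally_equal (fun eps => momentum r w eps x)
    (fun eps => momentum r' w' eps x) ->
  order0 r x = order0 r' x /\ order0 w x = order0 w' x.
Proof.
move=> ad ad' Dx /formally_equal_cvg rr' /formally_equal_cvg qq'.
have rE : order0 r x = order0 r' x.
  by apply: eq_limits rr'; exact: cvg_expansion2.
split=> //; apply/rowP => i.
have r0 : 0 < order0 r' x by case: ad' => _ _ _; apply.
have qE : order0 r x * order0 w x 0 i = order0 r' x * order0 w' x 0 i.
  have [_ _ c _] := momentum_limit i i ad Dx.
  have [_ _ c' _] := momentum_limit i i ad' Dx.
  apply: eq_limits c c' _.
  have := @coord_continuous R 1 d 0 i 0; rewrite /continuous_at mxE => c0.
  rewrite (_ : (fun eps => _) = (fun B : 'rV[R]_d => B 0 i) \o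
      (fun eps => momentum r w eps x - momentum r' w' eps x)).
    exact: (cvg_comp _ _ qq' c0).
  by apply/funext => eps; rewrite /= !mxE.
by apply: (mulfI (lt0r_neq0 r0)); rewrite -qE rE.
Qed.

Theorem proposition4p8 (R : realType) (d : nat) (hd : (1 <= d <= 3)%N)
    (D : geometry R d) (hD : geometry_ok D)
    (gamma : R) (hgamma : 1 <= gamma) (dt : R) (hdt : 0 < dt)
    (s : nat) (At A : 'M[R]_s.+1) (wt w : 'rV[R]_s.+1)
    (hRK : dimex_rk At A wt w)
    (hGSA : globally_stiffly_accurate At A wt w)
    (htype : type_A A \/ type_CK A)
    (rhon : ansatz R d R^o) (un : ansatz R d 'rV[R]_d)
    (hn : admissible_state D rhon un) (hwp : well_prepared D rhon un)
    (rho : 'I_s.+1 -> ansatz R d R^o) (u : 'I_s.+1 -> ansatz R d 'rV[R]_d)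
    (hstages : forall k, admissible_state D (rho k) (u k))
    (hmass : forall k, mass_stage D dt A rhon rho u k)
    (hmom : forall k, momentum_stage D gamma dt At A rhon un rho u k)
    (rhon1 : ansatz R d R^o) (un1 : ansatz R d 'rV[R]_d)
    (hn1 : admissible_state D rhon1 un1)
    (hfinal : final_update D rho u rhon1 un1)
    (hform : low_mach_form D rhon1 un1) :
  well_prepared D rhon1 un1 /\
  incompressible_scheme D dt At
    (order0 un) (fun k => order0 (u k)) (order0 un1).
Proof.
have [At0 A0 _ _] := hRK; have diagA := implicit_diag A0 htype.
have oD := points_open hD.
have near_eq (V : Type) (f g : 'rV[R]_d -> V) x :
    (forall y, points D y -> f y = g y) -> points D x -> {near x, f =1 g}.
  by move=> fg Dx; apply: filterS (open_nbhs_nbhs (conj oD Dx)) => y /fg.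
have gradP (f : 'rV[R]_d -> R) x : grad f x = 0 <-> forall i, partial i f x = 0.
  split=> [/rowP gf i|pf]; first by have := gf i; rewrite !mxE.
  by apply/rowP => i; rewrite !mxE.
have mom_bal k x i := @momentum_balance R d s D gamma dt At A hdt rhon un rho u hn hstages
  At0 A0 k x i (hmom k).
have mass_bal k x (Dx : points D x) := mass_balance hstages (hmass k) Dx.
have [x0 Dx0] := points_nonempty hD.
have rhon_pos x : points D x -> 0 < order0 rhon x by case: hn => _ _ _; apply.
have rho_pos k x : points D x -> 0 < order0 (rho k) x.
  by have [_ _ _] := hstages k; apply.
have rhonC : C1_on (points D) (order0 rhon) by case: hn => [[[]]].
have rhoC k : C1_on (points D) (order0 (rho k)) by have [[[]]] := hstages k.
have uC k i : C1_on (points D) (fun x => order0 (u k) x 0 i).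
  by have [_ [/(_ i)[]]] := hstages k.
pose r := order0 rhon x0.
have r0 : 0 < r by exact: rhon_pos.
have rhon_const x : points D x -> order0 rhon x = r.
  by move=> Dx; exact: (points_const hD rhonC (fun y Dy => (hwp.2 y Dy).1) Dx Dx0).
have mass_flux k x : points D x -> (forall i, partial i (order0 (rho k)) x = 0) ->
    \sum_i partial i (fun y => order0 (rho k) y * order0 (u k) y 0 i) x =
    order0 (rho k) x * div (order0 (u k)) x.
  move=> Dx gz; rewrite /div mulr_sumr; apply: eq_bigr => i _.
  rewrite (partialM ((C1_on_pC1 (rhoC k) Dx).2 i).1 ((C1_on_pC1 (uC k i) Dx).2 i).1).
  by rewrite gz mulr0 addr0.
have main k x : points D x -> [/\ forall i, partial i (order0 (rho k)) x = 0,
    order0 (rho k) x = r & div (order0 (u k)) x = 0].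
  have [n] := ubnP (k : nat); elim: n k x => // n IH k x /ltnSE kn Dx.
  have {}IH (l : 'I_s.+1) y : (l < k)%N -> points D y ->
      [/\ forall i, partial i (order0 (rho l)) y = 0,
          order0 (rho l) y = r & div (order0 (u l)) y = 0].
    by move=> lk; apply: IH; exact: leq_trans lk kn.
  (* In the explicit first stage only the order-0 parts are recovered from the data: the density by
     the mass equation, then the velocity by the order-0 momentum equation, whose sums vanish. *)
  have [Akk|Ak0] := diagA k; last first.
    have [k0 Ak] := Ak0.
    have rhoE y : points D y -> order0 (rho k) y = order0 rhon y.
      by move=> /(mass_bal k _) ->; rewrite big1 ?mulr0 ?subr0// => l _; rewrite Ak mul0r.
    have grad0 y i : points D y -> partial i (order0 (rho k)) y = 0.
      move=> Dy; rewrite (eq_near_partial i (near_eq _ _ _ _ rhoE Dy)).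
      by have [/gradP] := hwp.2 y Dy.
    have uE y : points D y -> order0 (u k) y = order0 un y.
      move=> Dy; apply/rowP => i; have [_ bal] := mom_bal k y i Dy.
      have gz (l : 'I_s.+1) : (l <= k)%N -> partial i (order0 (rho l)) y = 0.
        move=> lk; rewrite (_ : l = k) ?grad0//; apply/val_inj/eqP.
        by move: lk; rewrite k0 leqn0.
      move: (bal gz); rewrite [X in _ - X = _ -> _]big1 => [|l]; last by rewrite k0 ltn0.
      rewrite [X in _ = X -> _]big1 => [|l _]; last first.
        by rewrite /stiff_coef Ak At0 ?k0// !mul0r addr0 mul0r addr0.
      rewrite subr0 rhoE// -mulrBr => /eqP.
      rewrite mulf_eq0 invr_eq0 (gt_eqF hdt)/= mulf_eq0 (gt_eqF (rhon_pos y Dy))/=.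
      by rewrite subr_eq0 => /eqP.
    split; [by move=> i; exact: grad0|by rewrite rhoE// rhon_const|].
    rewrite (@divE _ _ (fun i y => order0 un y 0 i)).
      by have [_] := hwp.2 x Dx.
    by move=> i; apply: near_eq Dx => y Dy; rewrite uE.
  (* The diagonal of [At] is zero, so the gradient of the [k]-th density enters with the coefficient
     [A k k] alone; earlier gradients vanish by induction and later coefficients are 0. *)
  have grad0 y i : points D y -> partial i (order0 (rho k)) y = 0.
    move=> Dy; have [+ _] := mom_bal k y i Dy.
    rewrite (bigD1 k)//= big1 ?addr0 => [|l lk].
      rewrite /stiff_coef At0// mul0r add0r => /eqP.
      by rewrite mulf_eq0 (negPf Akk) => /eqP.
    have [ll|kl] := ltnP l k; first by have [-> _ _] := IH l y ll Dy; rewrite mulr0.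
    have kl' : (k < l)%N by rewrite ltn_neqAle eq_sym lk.
    by rewrite /stiff_coef At0// A0// mul0r addr0 mul0r.
  pose rk := order0 (rho k) x0.
  have rk_const y : points D y -> order0 (rho k) y = rk.
    move=> Dy; apply: (points_const hD (rhoC k) _ Dy Dx0) => z Dz.
    by apply/gradP => i; exact: grad0.
  have mass_k y : points D y -> rk = r - dt * (A k k * (rk * div (order0 (u k)) y)).
    move=> Dy; rewrite -{1}(rk_const y Dy) (mass_bal k y Dy) rhon_const//.
    congr (_ - _ * _); rewrite (bigD1 k)//= [X in _ + X]big1 ?addr0.
      by rewrite mass_flux ?rk_const// => i; exact: grad0.
    move=> l /andP[lk nlk]; have ll : (l < k)%N by rewrite ltn_neqAle nlk.
    have [gl _ dl] := IH l y ll Dy.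
    by rewrite mass_flux// dl !mulr0.
  have rk0 : 0 < rk by exact: rho_pos.
  (* The value of the divergence obtained by solving [mass_k], independent of the point. *)
  pose c := (r - rk) / (dt * A k k * rk).
  have div_c y : points D y -> div (order0 (u k)) y = c.
    move=> Dy; rewrite /c {1}(mass_k y Dy); field.
    by rewrite Akk !gt_eqF.
  have c0 : c = 0.
    have [_ [sv _ _] [bc _ _] _] := hstages k.
    exact: (div_const hD sv bc div_c).
  split; [by move=> i; exact: grad0| |by rewrite div_c].
  rewrite rk_const//; have := mass_k x Dx.
  by rewrite div_c// c0 !mulr0 subr0.
have final x : points D x -> order0 rhon1 x = order0 (rho ord_max) x /\
    order0 un1 x = order0 (u ord_max) x.
  move=> Dx; have [rf qf] := hfinal x Dx.
  exact: formally_equal_order0 hn1 (hstages ord_max) Dx rf qf.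
split.
  split=> // x Dx; have [gm _ dm] := main ord_max x Dx; split.
    apply/gradP => i; rewrite -(gm i); apply: eq_near_partial.
    by apply: near_eq Dx => y /final[].
  rewrite -dm; apply: divE => i.
  by apply: near_eq Dx => y /final[_ ->].
split; last first.
  by split=> [k x Dx|x /final[]//]; have [] := main k x Dx.
(* The mass equation at order 0 says nothing about [order1 (rho ord0)] in the CK
   case, so the quadratic term of the expansion of the pressure must be kept. *)
pose psi k x := r^-1 * \sum_l (stiff_coef gamma At A k l r * order2 (rho l) x +
  At k l * ddpressure gamma r / 2 * (order1 (rho l) x * order1 (rho l) x)).
exists psi => k; split.
  have s1 l : smooth_scalar D (order1 (rho l)) by case: (hstages l) => [[]].
  have s2 l : smooth_scalar D (order2 (rho l)) by case: (hstages l) => [[]].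
  have sterm l := smoothD hD
    (smoothM hD (smooth_cst D (stiff_coef gamma At A k l r)) (s2 l))
    (smoothM hD (smooth_cst D (At k l * ddpressure gamma r / 2))
      (smoothM hD (s1 l) (s1 l))).
  exact: (smoothM hD (smooth_cst D r^-1) (smooth_sum xpredT hD sterm)).
move=> x Dx; apply/rowP => i.
have psiE : partial i (psi k) x = r^-1 * \sum_l
    (At k l * (ddpressure gamma r * order1 (rho l) x) * partial i (order1 (rho l)) x +
     stiff_coef gamma At A k l r * partial i (order2 (rho l)) x).
  have term l : is_derive x (delta_mx 0 i) (fun y =>
      stiff_coef gamma At A k l r * order2 (rho l) y +
      At k l * ddpressure gamma r / 2 * (order1 (rho l) y * order1 (rho l) y))
      (stiff_coef gamma At A k l r * partial i (order2 (rho l)) x +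
       At k l * ddpressure gamma r / 2 *
        (order1 (rho l) x * partial i (order1 (rho l)) x +
         order1 (rho l) x * partial i (order1 (rho l)) x)).
    have [_ /derivableP d1 /derivableP d2] := admissible_derivable i (hstages l) Dx.
    exact: (is_deriveD (is_deriveZ _ d2) (is_deriveZ _ (is_deriveM d1 d1))).
  have psi_fun : psi k = r^-1 \*: \sum_l (fun y : 'rV[R]_d =>
      stiff_coef gamma At A k l r * order2 (rho l) y +
      At k l * ddpressure gamma r / 2 * (order1 (rho l) y * order1 (rho l) y)).
    by apply/funext => y; rewrite /psi /= fct_sumE.
  have [_ dE] := is_deriveZ r^-1 (is_derive_sum term).
  apply: etrans (etrans (congr1 (fun f => 'D_(delta_mx 0 i) f x) psi_fun) dE) _.
  by congr (_ * _); apply: eq_bigr => l _; field.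
have fluxE l : \sum_j partial j (fun y => order0 (rho l) y *
    (order0 (u l) y 0 i * order0 (u l) y 0 j)) x =
    r * div_tensor (fun y => tensor (order0 (u l) y) (order0 (u l) y)) x 0 i.
  have [gl rl _] := main l x Dx.
  rewrite mxE mulr_sumr; apply: eq_bigr => j _.
  have du m : derivable (fun y => order0 (u l) y 0 m) x (delta_mx 0 j).
    by have [_ /(_ j)[]] := C1_on_pC1 (uC l m) Dx.
  rewrite (partialM ((C1_on_pC1 (rhoC l) Dx).2 j).1 (derivableM (du i) (du j))).
  rewrite gl mulr0 addr0 rl (_ : (fun y => tensor _ _ i j) =
    fun y => order0 (u l) y 0 i * order0 (u l) y 0 j)//.
  by apply/funext => y; rewrite !mxE big_ord1 !mxE.
have [_ bal] := mom_bal k x i Dx.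
have /bal {}bal : forall l : 'I_s.+1, (l <= k)%N -> partial i (order0 (rho l)) x = 0.
  by move=> l _; have [] := main l x Dx.
have [_ rk _] := main k x Dx.
rewrite !mxE summxE psiE.
move: bal; rewrite rhon_const// rk.
under eq_bigr do rewrite fluxE.
rewrite [X in _ = X -> _](eq_bigr (fun l => At k l * (ddpressure gamma r * order1 (rho l) x) *
    partial i (order1 (rho l)) x +
    stiff_coef gamma At A k l r * partial i (order2 (rho l)) x)); last first.
  by move=> l _; have [_ -> _] := main l x Dx.
move=> <-.
have -> : \sum_(l < s.+1 | (l < k)%N) At k l *
    (r * div_tensor (fun y => tensor (order0 (u l) y) (order0 (u l) y)) x 0 i) =
    r * \sum_(l < s.+1 | (l < k)%N)
      (At k l *: div_tensor (fun y => tensor (order0 (u l) y) (order0 (u l) y)) x) 0 i.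
  by rewrite mulr_sumr; apply: eq_bigr => l _; rewrite [in RHS]mxE mulrCA.
by field; rewrite !gt_eqF.
Qed.
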